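(* Let $A$ be a locally retractive MV-algebra and let $\mathfrak A$ be the MV-algebra associated with $A$ as defined in the context (the algebra of global sections of the MV-sheaf of Abelian $\ell$-groups associated with $A$). Then the MV-algebras $A$ and $\mathfrak A$ are isomorphic. So, any locally retractive MV-algebra is isomorphic to the algebra of global sections of an MV-sheaf of Abelian $\ell$-groups.
   Context: **MV-algebra notation.** An MV-algebra is $(A,\oplus,{}^*,0)$; $x\odot y=(x^*\oplus y^* )^*$, $x\ominus y=x\odot y^*$. $\operatorname{Max}A$ is the set of maximal ideals, $\operatorname{Rad}A$ is the intersection of all maximal ideals, and for $M\in\operatorname{Max}A$, $O_M=\bigcap\{Q : Q \text{ minimal prime ideal of } A,\ Q\subseteq M\}$. One has $\operatorname{Rad}(A/O_M)=M/O_M$, so $(A/O_M)/\operatorname{Rad}(A/O_M)\cong A/M$. An MV-algebra $B$ has *retractive radical* if there is an embedding $j:B/\operatorname{Rad}B\to B$ with $p\circ j=\mathrm{id}$, where $p:B\to B/\operatorname{Rad}B$ is the natural projection. $A$ is *locally retractive* if $A/O_M$ has retractive radical for all $M\in\operatorname{Max}A$. **Fuzzy sets.** For each $M\in \operatorname{Max}A$ there is a unique embedding $\iota_M:A/M\to[0,1]$; for $a\in A$ let $\widehat a:\operatorname{Max}A\to[0,1]$, $\widehat a(M)=\iota_M(a/M)$ (also written $\frac aM$). An *MV-topology* on a set $X$ is a subset of $[0,1]^X$ containing the constants $\mathbf 0,\mathbf 1$ and closed under arbitrary joins and under binary $\odot,\oplus,\wedge$ (computed pointwise in the standard MV-algebra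 $[0,1]$). $\tau_A$ is the MV-topology on $\operatorname{Max}A$ whose elements are all joins of sets of fuzzy sets $\widehat a$, $a\in A$. **Stalks.** Let $A$ be locally retractive. For every $M\in\operatorname{Max}A$ fix an embedding $A/M\to A/O_M$ that is right inverse to the natural projection $A/O_M\to A/M$, and identify $a/M$ with its image in $A/O_M$ whenever needed. Let $G(M/O_M)$ be the Abelian $\ell$-group of differences of the cancellative lattice-ordered monoid $(M/O_M,\oplus,0)$, and set $$g_{aM}=\Big(\tfrac{a}{O_M}\ominus\tfrac{a}{M}\Big)-\Big(\tfrac{a}{M}\ominus\tfrac{a}{O_M}\Big)\in G(M/O_M).$$ **The MV-sheaf and its sections.** Let $H_A=\{(g_{aM},M):a\in A,\ M\in\operatorname{Max}A\}$, $\pi:H_A\to\operatorname{Max}A$, $\pi(g_{aM},M)=M$, and $\widetilde a:\operatorname{Max}A\to H_A$, $\widetilde a(M)=(g_{aM},M)$. $H_A$ carries the MV-topology generated by the fuzzy sets $\widetilde a^{\to}(\widehat b)$ ($a,b\in A$), where $\widetilde a^{\to}(\widehat b)(y)=\bigvee_{\widetilde a(N)=y}\widehat b(N)$. $(H_A,\pi,\operatorname{Max}A)$ is the MV-sheaf space of Abelian $\ell$-groups associated with $A$. For $a\in A$ put $$\mathfrak a=\Big\{\Big(\tfrac aM,\,g_{aM}\Big)\Big\}_{M\in\operatorname{Max}A}$$ (a family indexed by $\operatorname{Max}A$; it is the inverse of the graph of $\widetilde a^{\to}(\widehat a)$ restricted to the image of $\widetilde a$). **The algebra $\mathfrak A$.**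 $\mathfrak A=\{\mathfrak a:a\in A\}$ with: $\mathfrak o$ the family associated with $0\in A$; $\mathfrak a\oplus\mathfrak b$ the family $\{(\frac{a\oplus b}{M},g_{(a\oplus b)M})\}_{M}$ associated with $a\oplus b$; $\mathfrak a^*$ the family $\{(\frac{a^*}{M},g_{(a^* )M})\}_M$ associated with $a^*$. ''The algebra of global sections of an MV-sheaf of Abelian $\ell$-groups'' here refers to such an $\mathfrak A$. *)

(* Defs.v *)
From HB Require Import structures.
From mathcomp Require Import all_boot all_order all_algebra.
From mathcomp Require Import all_classical all_reals.
From mathcomp Require Import interval_inference lra ssrAC.

Set Implicit Arguments.
Unset Strict Implicit.
Unset Printing Implicit Defensive.

Import Order.TTheory GRing.Theory Num.Theory.
Import generic_quotient.

Local Open Scope classical_set_scope.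
Local Open Scope quotient_scope.
Local Open Scope ring_scope.

Declare Scope mv_scope.
Delimit Scope mv_scope with MV.
Local Open Scope mv_scope.

HB.mixin Record isMV (A : Type) := {
  mv0 : A;
  mvadd : A -> A -> A;
  mvneg : A -> A;
  mvaddA : associative mvadd;
  mvaddC : commutative mvadd;
  mvadd0 : right_id mv0 mvadd;
  mvnegK : involutive mvneg;
  mvadd_neg0 : forall x, mvadd x (mvneg mv0) = mvneg mv0;
  mv_luk : forall x y,
    mvadd (mvneg (mvadd (mvneg x) y)) y = mvadd (mvneg (mvadd (mvneg y) x)) x
}.

#[short(type="mvAlgType")]
HB.structure Definition MVAlgebra := {A of isMV A & Choice A}.

Notation "¬ x" := (mvneg x) (at level 35, right associativity) : mv_scope.
Notation "x ⊕ y" := (mvadd x y) (at level 50, left associativity) : mv_scope.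

Definition mvmul (A : mvAlgType) (x y : A) : A := ¬ (¬ x ⊕ ¬ y).
Notation "x ⊙ y" := (mvmul x y) (at level 40, left associativity) : mv_scope.

Definition mvsub (A : mvAlgType) (x y : A) : A := x ⊙ ¬ y.
Notation "x ⊖ y" := (mvsub x y) (at level 50, left associativity) : mv_scope.

Definition mv1 (A : mvAlgType) : A := ¬ mv0.
Definition mvle (A : mvAlgType) (x y : A) : bool := x ⊖ y == mv0.
Definition mvjoin (A : mvAlgType) (x y : A) : A := (x ⊖ y) ⊕ y.
Definition mvmeet (A : mvAlgType) (x y : A) : A := ¬ mvjoin (¬ x) (¬ y).
Definition mvdist (A : mvAlgType) (x y : A) : A := (x ⊖ y) ⊕ (y ⊖ x).

Definition mvAlg_of (A : choiceType) (S : isMV A) : mvAlgType :=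
  HB.pack_for mvAlgType (Choice.sort A) S A.

Definition mv_hom (A B : mvAlgType) (f : A -> B) : Prop :=
  [/\ f mv0 = mv0, forall x y, f (x ⊕ y) = f x ⊕ f y
    & forall x, f (¬ x) = ¬ f x].

Definition mv_embedding (A B : mvAlgType) (f : A -> B) : Prop :=
  mv_hom f /\ injective f.

Definition mv_isomorphic (A B : mvAlgType) : Prop :=
  exists f : A -> B, mv_hom f /\ bijective f.

Section MVTheory.
Variable A : mvAlgType.
Implicit Types x y z t : A.

Lemma mv0add x : mv0 ⊕ x = x. Proof. by rewrite mvaddC mvadd0. Qed.

Lemma mvadd1 x : x ⊕ mv1 A = mv1 A. Proof. exact: mvadd_neg0. Qed.

Lemma mvneg1 : ¬ mv1 A = mv0. Proof. exact: mvnegK. Qed.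

Lemma mvaddN x : x ⊕ ¬ x = mv1 A.
Proof.
by have := mv_luk x (mv1 A); rewrite !mvadd1 mvneg1 mv0add mvaddC => <-.
Qed.

Lemma mvsubE x y : x ⊖ y = ¬ (¬ x ⊕ y).
Proof. by rewrite /mvsub /mvmul mvnegK. Qed.

Lemma mvleE x y : mvle x y = (¬ x ⊕ y == mv1 A).
Proof.
rewrite /mvle mvsubE; apply/eqP/eqP => [h|->]; last exact: mvneg1.
by rewrite -[LHS]mvnegK h.
Qed.

Lemma mvlexx x : mvle x x.
Proof. by rewrite mvleE mvaddC mvaddN. Qed.

Lemma mvjoinC x y : mvjoin x y = mvjoin y x.
Proof. by rewrite /mvjoin !mvsubE mv_luk. Qed.

Lemma mvle_joinE x y : mvle x y -> mvjoin x y = y.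
Proof. by move=> /eqP h; rewrite /mvjoin h mv0add. Qed.

Lemma mvle_subK x y : mvle x y -> (y ⊖ x) ⊕ x = y.
Proof. by move=> h; rewrite -/(mvjoin y x) mvjoinC mvle_joinE. Qed.

Lemma mvle_anti x y : mvle x y -> mvle y x -> x = y.
Proof. by move=> xy yx; rewrite -(mvle_joinE yx) mvjoinC mvle_joinE. Qed.

Lemma mvle_addr x y : mvle x (x ⊕ y).
Proof. by rewrite mvleE mvaddA (mvaddC _ x) mvaddN mvaddC mvadd1. Qed.

Lemma mvle_addl x y : mvle x (y ⊕ x).
Proof. by rewrite mvaddC mvle_addr. Qed.

Lemma mvle_trans y x z : mvle x y -> mvle y z -> mvle x z.
Proof.
move=> xy yz; rewrite -(mvle_subK yz) -(mvle_subK xy).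
by rewrite mvaddA mvle_addl.
Qed.

Lemma mvle_add2r z x y : mvle x y -> mvle (x ⊕ z) (y ⊕ z).
Proof. by move=> /mvle_subK <-; rewrite -mvaddA mvle_addl. Qed.

Lemma mvle_add x y z t : mvle x y -> mvle z t -> mvle (x ⊕ z) (y ⊕ t).
Proof.
move=> xy zt; apply: (mvle_trans (mvle_add2r z xy)).
by rewrite ![y ⊕ _]mvaddC mvle_add2r.
Qed.

Lemma mvle_sub x y z : mvle (x ⊖ y) z = mvle x (y ⊕ z).
Proof. by rewrite !mvleE mvsubE mvnegK mvaddA. Qed.

Lemma mvle_subDl x y : mvle x (y ⊕ (x ⊖ y)).
Proof. by rewrite -mvle_sub mvlexx. Qed.

Lemma mvle_subDr x y : mvle x ((x ⊖ y) ⊕ y).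
Proof. by rewrite [_ ⊕ y]mvaddC mvle_subDl. Qed.

Lemma mvleN x y : mvle (¬ x) (¬ y) = mvle y x.
Proof. by rewrite !mvleE mvnegK mvaddC. Qed.

Lemma mvjoin_lub x y z : mvle (mvjoin x y) z = mvle x z && mvle y z.
Proof.
have ubl (u v : A) : mvle u (mvjoin u v) by exact: mvle_subDr.
apply/idP/andP => [h|[xz yz]].
  by split; apply: mvle_trans h => //; rewrite mvjoinC.
rewrite -(mvle_subK yz); apply: mvle_add2r.
by rewrite mvle_sub mvaddC mvle_subK.
Qed.

Lemma mvmeet_glb x y z : mvle x (mvmeet y z) = mvle x y && mvle x z.
Proof. by rewrite -mvleN /mvmeet mvnegK mvjoin_lub !mvleN. Qed.

Lemma mvsubN x y : ¬ x ⊖ ¬ y = y ⊖ x.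
Proof. by rewrite !mvsubE mvnegK mvaddC. Qed.

Lemma mvsub_triangle y x z : mvle (x ⊖ z) ((x ⊖ y) ⊕ (y ⊖ z)).
Proof.
rewrite mvle_sub mvaddC -mvaddA; apply: (mvle_trans (mvle_subDr x y)).
by apply: mvle_add (mvlexx _) _; exact: mvle_subDr.
Qed.

Lemma mvsub_add x y z t : mvle ((x ⊕ y) ⊖ (z ⊕ t)) ((x ⊖ z) ⊕ (y ⊖ t)).
Proof.
rewrite mvle_sub.
apply: (mvle_trans (mvle_add (mvle_subDl x z) (mvle_subDl y t))).
rewrite -!mvaddA; apply: mvle_add (mvlexx _) _.
by rewrite !mvaddA; apply: mvle_add2r; rewrite [t ⊕ _]mvaddC mvlexx.
Qed.

End MVTheory.

Record ideal (A : mvAlgType) := Ideal {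
  ideal_set :> A -> Prop;
  ideal0 : ideal_set mv0;
  idealD : forall x y, ideal_set x -> ideal_set y -> ideal_set (x ⊕ y);
  ideal_le : forall x y, mvle x y -> ideal_set y -> ideal_set x
}.

Definition ideal_sub (A : mvAlgType) (I J : ideal A) : Prop :=
  ideal_set I `<=` ideal_set J.

Definition proper (A : mvAlgType) (I : ideal A) : Prop :=
  ideal_set I <> [set: A].

(* Standard for MV-algebras: A/P is a nontrivial chain. *)
Definition is_prime (A : mvAlgType) (P : ideal A) : Prop :=
  proper P /\ forall x y : A, P (x ⊖ y) \/ P (y ⊖ x).

Definition is_minimal_prime (A : mvAlgType) (P : ideal A) : Prop :=
  is_prime P /\ forall Q : ideal A, is_prime Q -> ideal_sub Q P -> ideal_sub P Q.

Definition is_maximal (A : mvAlgType) (M : ideal A) : Prop :=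
  proper M /\ forall J : ideal A, proper J -> ideal_sub M J -> ideal_sub J M.

Record maxIdeal (A : mvAlgType) := MaxIdeal {
  max_ideal :> ideal A;
  max_idealP : is_maximal max_ideal
}.

Section IdealInter.
Variables (A : mvAlgType) (F : set (ideal A)).

Definition inter_set : set A := [set x | forall I : ideal A, F I -> I x].

Fact ideal_inter0 : inter_set mv0. Proof. by move=> I _; exact: ideal0. Qed.

Fact ideal_interD x y : inter_set x -> inter_set y -> inter_set (x ⊕ y).
Proof. by move=> hx hy I FI; apply: idealD; [exact: hx|exact: hy]. Qed.

Fact ideal_inter_le x y : mvle x y -> inter_set y -> inter_set x.
Proof. by move=> xy hy I FI; exact: ideal_le xy (hy _ FI). Qed.

Definition ideal_inter : ideal A :=
  Ideal ideal_inter0 ideal_interD ideal_inter_le.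

End IdealInter.

Definition Rad (A : mvAlgType) : ideal A := ideal_inter (@is_maximal A).

Definition O_ (A : mvAlgType) (M : maxIdeal A) : ideal A :=
  ideal_inter [set Q | is_minimal_prime Q /\ ideal_sub Q M].

Section Quotient.
Variables (A : mvAlgType) (I : ideal A).

Definition congr_rel : rel A := [rel x y | `[< I (mvdist x y) >]].

Lemma congrP x y : reflect (I (x ⊖ y) /\ I (y ⊖ x)) (congr_rel x y).
Proof.
apply: (iffP (asboolP _)) => [h|[h1 h2]]; last exact: idealD.
by split; apply: ideal_le h; [exact: mvle_addr|exact: mvle_addl].
Qed.

Fact congr_refl : reflexive congr_rel.
Proof.
move=> x; apply/congrP; have /eqP -> : mvle x x by exact: mvlexx.
by split; exact: ideal0.
Qed.

Fact congr_sym : symmetric congr_rel.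
Proof. by move=> x y; apply/congrP/congrP => -[]. Qed.

Fact congr_trans : transitive congr_rel.
Proof.
move=> y x z /congrP[xy yx] /congrP[yz zy]; apply/congrP; split.
  by apply: ideal_le (mvsub_triangle y x z) _; exact: idealD.
by apply: ideal_le (mvsub_triangle y z x) _; exact: idealD.
Qed.

Canonical congr_equiv : equiv_rel A :=
  EquivRel congr_rel congr_refl congr_sym congr_trans.

Definition mvquot : Type := {eq_quot congr_equiv}.
HB.instance Definition _ := Choice.on mvquot.
HB.instance Definition _ := EqQuotient.on mvquot.

Definition mvpi (x : A) : mvquot := \pi_mvquot x.

Lemma mvpi_eq x y : mvpi x = mvpi y <-> I (x ⊖ y) /\ I (y ⊖ x).
Proof.
split=> [/eqquotP/congrP //|h]; apply/eqquotP; exact/congrP.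
Qed.

Lemma mvpi_repr (u : mvquot) : mvpi (repr u) = u.
Proof. exact: reprK. Qed.

Definition quot_add (u v : mvquot) : mvquot := mvpi (repr u ⊕ repr v).
Definition quot_neg (u : mvquot) : mvquot := mvpi (¬ repr u).

Lemma quot_addE x y : quot_add (mvpi x) (mvpi y) = mvpi (x ⊕ y).
Proof.
have /mvpi_eq[x1 x2] := mvpi_repr (mvpi x).
have /mvpi_eq[y1 y2] := mvpi_repr (mvpi y).
by apply/mvpi_eq; split; apply: ideal_le (mvsub_add _ _ _ _) _; exact: idealD.
Qed.

Lemma quot_negE x : quot_neg (mvpi x) = mvpi (¬ x).
Proof.
have /mvpi_eq[x1 x2] := mvpi_repr (mvpi x).
by apply/mvpi_eq; rewrite !mvsubN.
Qed.

Fact quot_addA : associative quot_add.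
Proof.
move=> u v w; rewrite -(mvpi_repr u) -(mvpi_repr v) -(mvpi_repr w).
by rewrite !quot_addE mvaddA.
Qed.

Fact quot_addC : commutative quot_add.
Proof. by move=> u v; rewrite /quot_add mvaddC. Qed.

Fact quot_add0 : right_id (mvpi mv0) quot_add.
Proof. by move=> u; rewrite -(mvpi_repr u) quot_addE mvadd0. Qed.

Fact quot_negK : involutive quot_neg.
Proof. by move=> u; rewrite -(mvpi_repr u) !quot_negE mvnegK. Qed.

Fact quot_add_neg0 u :
  quot_add u (quot_neg (mvpi mv0)) = quot_neg (mvpi mv0).
Proof. by rewrite -(mvpi_repr u) quot_negE quot_addE mvadd_neg0. Qed.

Fact quot_luk u v : quot_add (quot_neg (quot_add (quot_neg u) v)) v
  = quot_add (quot_neg (quot_add (quot_neg v) u)) u.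
Proof.
rewrite -(mvpi_repr u) -(mvpi_repr v).
by rewrite !(quot_negE, quot_addE) mv_luk.
Qed.

HB.instance Definition _ := isMV.Build mvquot
  quot_addA quot_addC quot_add0 quot_negK quot_add_neg0 quot_luk.

Lemma mvpi0 : mvpi mv0 = mv0. Proof. by []. Qed.

Lemma mvpiD x y : mvpi (x ⊕ y) = mvpi x ⊕ mvpi y.
Proof. by rewrite -quot_addE. Qed.

Lemma mvpiN x : mvpi (¬ x) = ¬ mvpi x.
Proof. by rewrite -quot_negE. Qed.

Lemma mvpiB x y : mvpi (x ⊖ y) = mvpi x ⊖ mvpi y.
Proof. by rewrite !mvsubE mvpiN mvpiD mvpiN. Qed.

End Quotient.

(* The natural projection A/I -> A/J; independent of the representative when
   I is contained in J. *)
Definition quot_proj (A : mvAlgType) (I J : ideal A) (u : mvquot I) :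
  mvquot J := mvpi J (repr u).

Definition retractive_radical (B : mvAlgType) : Prop :=
  exists j : mvquot (Rad B) -> B,
    mv_embedding j /\ forall u, mvpi (Rad B) (j u) = u.

Definition locally_retractive (A : mvAlgType) : Prop :=
  forall M : maxIdeal A, retractive_radical (mvquot (O_ M)).

(* Not Order.Lattice: the hierarchy of [Num] does not admit a join of
   Order.Lattice with GRing.Nmodule or GRing.Zmodule. *)
HB.mixin Record hasLatticeOrder M := {
  lle : rel M;
  lle_refl : reflexive lle;
  lle_anti : antisymmetric lle;
  lle_trans : transitive lle;
  ljoin : M -> M -> M;
  lmeet : M -> M -> M;
  ljoinP : forall x y z, lle (ljoin x y) z = lle x z && lle y z;
  lmeetP : forall x y z, lle x (lmeet y z) = lle x y && lle x z
}.

HB.structure Definition LatticeOrdered := {M of hasLatticeOrder M}.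

Notation "x ≼ y" := (lle x y) (at level 70, no associativity) : mv_scope.

HB.structure Definition OrderedNmodule :=
  {M of GRing.Nmodule M & LatticeOrdered M}.

HB.mixin Record isCancLMonoid M
    of GRing.Nmodule M & LatticeOrdered M := {
  clmon_addI : forall z : M, injective (+%R z);
  clmon_leD2l : forall z x y : M, (z + x ≼ z + y) = (x ≼ y);
  clmon_addU : forall z x y : M, z + ljoin x y = ljoin (z + x) (z + y);
  clmon_addM : forall z x y : M, z + lmeet x y = lmeet (z + x) (z + y)
}.

#[short(type="cancLMonoidType")]
HB.structure Definition CancLMonoid :=
  {M of isCancLMonoid M & GRing.Nmodule M & LatticeOrdered M}.

HB.mixin Record isAbelianLGroup G
    of GRing.Zmodule G & LatticeOrdered G := {
  lgrp_leD2l : forall z x y : G, x ≼ y -> z + x ≼ z + y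
}.

#[short(type="lgroupType")]
HB.structure Definition AbelianLGroup :=
  {G of isAbelianLGroup G & GRing.Zmodule G & LatticeOrdered G}.

Section Differences.
Variable M : cancLMonoidType.
Implicit Types (p q r : M * M).

(* (x, y) stands for the formal difference x - y. *)
Definition diff_rel : rel (M * M) := [rel p q | p.1 + q.2 == q.1 + p.2].

Fact diff_refl : reflexive diff_rel. Proof. by move=> p; exact: eqxx. Qed.

Fact diff_sym : symmetric diff_rel. Proof. by move=> p q; exact: eq_sym. Qed.

Fact diff_trans : transitive diff_rel.
Proof.
move=> q p r /= /eqP pq /eqP qr; apply/eqP; apply: (@clmon_addI M q.2).
rewrite (AC (1*2) ((2*1)*3)) /= pq (AC (2*1) ((1*3)*2)) /= qr.
by rewrite (AC (2*1) (2*(1*3))) /=.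
Qed.

Canonical diff_equiv : equiv_rel (M * M) :=
  EquivRel diff_rel diff_refl diff_sym diff_trans.

Definition diffgrp : Type := {eq_quot diff_equiv}.
HB.instance Definition _ := Choice.on diffgrp.
HB.instance Definition _ := EqQuotient.on diffgrp.

Definition dpi (p : M * M) : diffgrp := \pi_diffgrp p.

Lemma dpi_eq p q : dpi p = dpi q <-> p.1 + q.2 = q.1 + p.2.
Proof. by split=> [/eqquotP/eqP|h] //; apply/eqquotP/eqP. Qed.

Lemma dpi_repr (u : diffgrp) : dpi (repr u) = u.
Proof. exact: reprK. Qed.

Definition diff_of (x : M) : diffgrp := dpi (x, 0).

Definition diff_add (u v : diffgrp) : diffgrp :=
  dpi ((repr u).1 + (repr v).1, (repr u).2 + (repr v).2).
Definition diff_opp (u : diffgrp) : diffgrp := dpi ((repr u).2, (repr u).1).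
Definition diff_le (u v : diffgrp) : bool :=
  (repr u).1 + (repr v).2 ≼ (repr v).1 + (repr u).2.
Definition diff_join (u v : diffgrp) : diffgrp :=
  dpi (ljoin ((repr u).1 + (repr v).2) ((repr v).1 + (repr u).2),
       (repr u).2 + (repr v).2).
Definition diff_meet (u v : diffgrp) : diffgrp :=
  dpi (lmeet ((repr u).1 + (repr v).2) ((repr v).1 + (repr u).2),
       (repr u).2 + (repr v).2).

Lemma diff_addE p q : diff_add (dpi p) (dpi q) = dpi (p.1 + q.1, p.2 + q.2).
Proof.
have /dpi_eq hp := dpi_repr (dpi p); have /dpi_eq hq := dpi_repr (dpi q).
by apply/dpi_eq => /=; rewrite addrACA hp hq addrACA.
Qed.

Lemma diff_oppE p : diff_opp (dpi p) = dpi (p.2, p.1).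
Proof.
have /dpi_eq hp := dpi_repr (dpi p).
by apply/dpi_eq => /=; rewrite addrC -hp addrC.
Qed.

Lemma diff_leE p q : diff_le (dpi p) (dpi q) = (p.1 + q.2 ≼ q.1 + p.2).
Proof.
have /dpi_eq hp := dpi_repr (dpi p); have /dpi_eq hq := dpi_repr (dpi q).
rewrite /diff_le; move: (repr (dpi p)) (repr (dpi q)) hp hq => p' q' hp hq.
rewrite -(clmon_leD2l (p.2 + q.2)) -[RHS](clmon_leD2l (p'.2 + q'.2)).
congr (_ ≼ _).
  rewrite [LHS](AC (2*2) ((3*1)*(2*4))) /= hp.
  by rewrite [RHS](AC (2*2) ((3*1)*(4*2))).
rewrite [LHS](AC (2*2) ((3*2)*(4*1))) /= hq.
by rewrite [RHS](AC (2*2) ((3*2)*(1*4))).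
Qed.

Fact diff_addA : associative diff_add.
Proof.
move=> u v w; rewrite -(dpi_repr u) -(dpi_repr v) -(dpi_repr w).
by rewrite !diff_addE /= !addrA.
Qed.

Fact diff_addC : commutative diff_add.
Proof.
by move=> u v; rewrite /diff_add ![(repr v).1 + _]addrC ![(repr v).2 + _]addrC.
Qed.

Fact diff_add0 : left_id (dpi (0, 0)) diff_add.
Proof.
by move=> u; rewrite -(dpi_repr u) diff_addE /= !add0r -surjective_pairing.
Qed.

Fact diff_addN : left_inverse (dpi (0, 0)) diff_opp diff_add.
Proof.
move=> u; rewrite -(dpi_repr u) diff_oppE diff_addE; apply/dpi_eq => /=.
by rewrite addr0 add0r addrC.
Qed.

HB.instance Definition _ :=
  GRing.isZmodule.Build diffgrp diff_addA diff_addC diff_add0 diff_addN.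

Fact diff_le_refl : reflexive diff_le. Proof. by move=> u; exact: lle_refl. Qed.

Fact diff_le_anti : antisymmetric diff_le.
Proof.
move=> u v; rewrite -(dpi_repr u) -(dpi_repr v) !diff_leE => h.
by apply/dpi_eq; apply: lle_anti.
Qed.

Fact diff_le_trans : transitive diff_le.
Proof.
move=> v u w; rewrite -(dpi_repr u) -(dpi_repr v) -(dpi_repr w) !diff_leE.
move: (repr u) (repr v) (repr w) => p q r pq qr.
rewrite -(clmon_leD2l q.2); apply: (@lle_trans M (r.2 + (q.1 + p.2))).
  by rewrite [X in X ≼ _](AC (1*2) (3*(2*1))) /= clmon_leD2l.
rewrite [X in X ≼ _](AC (1*2) (3*(2*1))) /= [X in _ ≼ X](AC (1*2) (3*(2*1))) /=.
by rewrite clmon_leD2l.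
Qed.

Fact diff_joinP (u v w : diffgrp) :
  diff_le (diff_join u v) w = diff_le u w && diff_le v w.
Proof.
rewrite /diff_join -(dpi_repr w) -[in RHS](dpi_repr u) -[in RHS](dpi_repr v).
rewrite !diff_leE /=; move: (repr u) (repr v) (repr w) => p q r.
rewrite addrC clmon_addU ljoinP; congr andb.
  rewrite -[RHS](clmon_leD2l q.2); congr (_ ≼ _).
    by rewrite (AC (1*2) (3*(2*1))) /=.
  by rewrite (AC (1*2) (3*(1*2))) /=.
rewrite -[RHS](clmon_leD2l p.2); congr (_ ≼ _).
  by rewrite (AC (1*2) (3*(2*1))) /=.
by rewrite (AC (1*2) (2*(1*3))) /=.
Qed.

Fact diff_meetP (u v w : diffgrp) :
  diff_le u (diff_meet v w) = diff_le u v && diff_le u w.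
Proof.
rewrite /diff_meet -(dpi_repr u) -[in RHS](dpi_repr v) -[in RHS](dpi_repr w).
rewrite !diff_leE /=; move: (repr u) (repr v) (repr w) => r p q.
rewrite [X in _ ≼ X]addrC clmon_addM lmeetP; congr andb.
  rewrite -[RHS](clmon_leD2l q.2); congr (_ ≼ _).
    by rewrite (AC (1*2) (3*(1*2))) /=.
  by rewrite (AC (1*2) (3*(2*1))) /=.
rewrite -[RHS](clmon_leD2l p.2); congr (_ ≼ _).
  by rewrite (AC (1*2) (2*(1*3))) /=.
by rewrite (AC (1*2) (3*(2*1))) /=.
Qed.

HB.instance Definition _ := hasLatticeOrder.Build diffgrp
  diff_le_refl diff_le_anti diff_le_trans diff_joinP diff_meetP.

Fact diff_leD2l (z x y : diffgrp) : x ≼ y -> z + x ≼ z + y.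
Proof.
rewrite -(dpi_repr x) -(dpi_repr y) -(dpi_repr z) /lle /= => h.
rewrite [_ + dpi (repr x)]diff_addE [_ + dpi (repr y)]diff_addE.
move: h; rewrite !diff_leE /= => h.
by rewrite addrACA [X in _ ≼ X]addrACA clmon_leD2l.
Qed.

HB.instance Definition _ := isAbelianLGroup.Build diffgrp diff_leD2l.

End Differences.

Section MVCancel.
Variable A : mvAlgType.
Implicit Types x y z : A.

Lemma mvmul0_le x y : x ⊙ y = mv0 -> mvle y (¬ x).
Proof.
move=> h; rewrite mvleE [¬ y ⊕ _]mvaddC -[X in X == _]mvnegK.
by rewrite -/(mvmul x y) h.
Qed.

Lemma mvmul0_addK x y : x ⊙ y = mv0 -> (x ⊕ y) ⊖ y = x.
Proof.
move=> /mvmul0_le h; rewrite mvsubE -[RHS]mvnegK; congr (¬ _).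
by rewrite -{1}[x]mvnegK -mvsubE -/(mvjoin _ _) mvjoinC mvle_joinE.
Qed.

Lemma mvmul0_leD2l z x y : x ⊙ z = mv0 -> mvle (z ⊕ x) (z ⊕ y) = mvle x y.
Proof. by move=> h; rewrite -mvle_sub [z ⊕ x]mvaddC mvmul0_addK. Qed.

Lemma mvle_joinl x y : mvle x (mvjoin x y).
Proof. exact: mvle_subDr. Qed.

Lemma mvle_joinr x y : mvle y (mvjoin x y).
Proof. by rewrite mvjoinC mvle_joinl. Qed.

Lemma mvle_meetl x y : mvle (mvmeet x y) x.
Proof. by have := mvlexx (mvmeet x y); rewrite mvmeet_glb => /andP[]. Qed.

Lemma mvle_meetr x y : mvle (mvmeet x y) y.
Proof. by have := mvlexx (mvmeet x y); rewrite mvmeet_glb => /andP[]. Qed.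

Lemma mvle_add2l z x y : mvle x y -> mvle (z ⊕ x) (z ⊕ y).
Proof. exact: mvle_add (mvlexx z). Qed.

Lemma mvjoin_le_add x y : mvle (mvjoin x y) (x ⊕ y).
Proof. by rewrite mvjoin_lub mvle_addr mvle_addl. Qed.

Lemma mvadd_meetr z x y : z ⊕ mvmeet x y = mvmeet (z ⊕ x) (z ⊕ y).
Proof.
apply: mvle_anti.
  by rewrite mvmeet_glb !mvle_add2l ?mvle_meetl ?mvle_meetr.
by rewrite -mvle_sub mvmeet_glb !mvle_sub mvle_meetl mvle_meetr.
Qed.

Lemma mvmul0_joinr z x y : x ⊙ z = mv0 -> y ⊙ z = mv0 ->
  z ⊕ mvjoin x y = mvjoin (z ⊕ x) (z ⊕ y).
Proof.
move=> xz yz; apply: mvle_anti; last first.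
  by rewrite mvjoin_lub !mvle_add2l ?mvle_joinl ?mvle_joinr.
set w := mvjoin (z ⊕ x) (z ⊕ y).
have zw : mvle z w := mvle_trans (mvle_addr z x) (mvle_joinl _ _).
rewrite -[X in mvle _ X](mvle_subK zw) [X in mvle _ X]mvaddC.
apply: mvle_add2l; rewrite mvjoin_lub.
rewrite -(mvmul0_leD2l _ xz) -(mvmul0_leD2l _ yz).
by rewrite [z ⊕ (w ⊖ z)]mvaddC mvle_subK // mvle_joinl mvle_joinr.
Qed.

End MVCancel.

Section Germs.
Variables (A : mvAlgType) (M : maxIdeal A).

Lemma mvpi_join (I : ideal A) (x y : A) :
  mvpi I (mvjoin x y) = mvjoin (mvpi I x) (mvpi I y).
Proof. by rewrite /mvjoin mvpiD mvpiB. Qed.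

Lemma mvpi_meet (I : ideal A) (x y : A) :
  mvpi I (mvmeet x y) = mvmeet (mvpi I x) (mvpi I y).
Proof. by rewrite /mvmeet mvpiN mvpi_join !mvpiN. Qed.

Lemma O_mul (x y : A) : M x -> M y -> O_ M (x ⊙ y).
Proof.
move=> Mx My /= Q [[[_ Qprime] _] QM].
case: (Qprime x (¬ y)); first by rewrite /mvsub mvnegK.
move=> /QM h; have [properM _] := max_idealP M; exfalso; apply: properM.
have MNy : M (¬ y).
  by apply: ideal_le (mvle_subDr (¬ y) x) _; exact: idealD.
apply/seteqP; split => // z _; apply: (@ideal_le _ M z (y ⊕ ¬ y)).
  by rewrite mvaddN mvleE mvadd1.
exact: idealD.
Qed.

(* M/O_M, as a subset of A/O_M *)
Definition germ_set : set (mvquot (O_ M)) := mvpi (O_ M) @` M.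

Lemma germ_setI (x : A) : M x -> mvpi (O_ M) x \in germ_set.
Proof. by move=> Mx; apply/mem_set; exists x. Qed.

Definition mgerm : Type := set_type germ_set.
HB.instance Definition _ := Choice.on mgerm.
HB.instance Definition _ := SubChoice.on mgerm.

Definition Germ (u : mvquot (O_ M)) (h : u \in germ_set) : mgerm :=
  exist (fun u => is_true (u \in germ_set)) u h.

Lemma mgermP (u : mgerm) : exists2 x, M x & mvpi (O_ M) x = val u.
Proof. exact: set_mem (valP u). Qed.

Lemma mgerm_mul (u v : mgerm) : val u ⊙ val v = mv0.
Proof.
have [x Mx <-] := mgermP u; have [y My <-] := mgermP v.
have -> : mvpi (O_ M) x ⊙ mvpi (O_ M) y = mvpi (O_ M) (x ⊙ y).
  by rewrite /mvmul mvpiN mvpiD !mvpiN.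
rewrite -mvpi0; apply/mvpi_eq; split.
  apply: (@ideal_le _ _ _ (x ⊙ y)); last exact: O_mul.
  by rewrite mvle_sub mv0add mvlexx.
apply: (@ideal_le _ _ _ mv0); last exact: ideal0.
by rewrite mvle_sub mvle_addl.
Qed.

Definition mgerm0 : mgerm := Germ (germ_setI (ideal0 M)).

Fact mgerm_add_subproof (u v : mgerm) : val u ⊕ val v \in germ_set.
Proof.
have [x Mx <-] := mgermP u; have [y My <-] := mgermP v.
by rewrite -mvpiD; apply/germ_setI/idealD.
Qed.

Fact mgerm_join_subproof (u v : mgerm) : mvjoin (val u) (val v) \in germ_set.
Proof.
have [x Mx <-] := mgermP u; have [y My <-] := mgermP v.
rewrite -mvpi_join; apply/germ_setI/(ideal_le (mvjoin_le_add x y)).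
exact: idealD.
Qed.

Fact mgerm_meet_subproof (u v : mgerm) : mvmeet (val u) (val v) \in germ_set.
Proof.
have [x Mx <-] := mgermP u; have [y My <-] := mgermP v.
by rewrite -mvpi_meet; apply/germ_setI/(ideal_le (mvle_meetl x y)).
Qed.

Definition mgerm_add (u v : mgerm) : mgerm := Germ (mgerm_add_subproof u v).
Definition mgerm_le (u v : mgerm) : bool := mvle (val u) (val v).
Definition mgerm_join (u v : mgerm) : mgerm :=
  Germ (mgerm_join_subproof u v).
Definition mgerm_meet (u v : mgerm) : mgerm :=
  Germ (mgerm_meet_subproof u v).

Fact mgerm_addA : associative mgerm_add.
Proof. by move=> u v w; apply: val_inj; exact: mvaddA. Qed.

Fact mgerm_addC : commutative mgerm_add.
Proof. by move=> u v; apply: val_inj; exact: mvaddC. Qed.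

Fact mgerm_add0 : left_id mgerm0 mgerm_add.
Proof. by move=> u; apply: val_inj; exact: mv0add. Qed.

HB.instance Definition _ :=
  GRing.isNmodule.Build mgerm mgerm_addA mgerm_addC mgerm_add0.

Fact mgerm_le_refl : reflexive mgerm_le.
Proof. by move=> u; exact: mvlexx. Qed.

Fact mgerm_le_anti : antisymmetric mgerm_le.
Proof. by move=> u v /andP[uv vu]; apply: val_inj; exact: mvle_anti. Qed.

Fact mgerm_le_trans : transitive mgerm_le.
Proof. by move=> v u w; exact: mvle_trans. Qed.

Fact mgerm_joinP (u v w : mgerm) :
  mgerm_le (mgerm_join u v) w = mgerm_le u w && mgerm_le v w.
Proof. exact: mvjoin_lub. Qed.

Fact mgerm_meetP (u v w : mgerm) :
  mgerm_le u (mgerm_meet v w) = mgerm_le u v && mgerm_le u w.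
Proof. exact: mvmeet_glb. Qed.

HB.instance Definition _ := hasLatticeOrder.Build mgerm
  mgerm_le_refl mgerm_le_anti mgerm_le_trans mgerm_joinP mgerm_meetP.

Fact mgerm_leD2l (z x y : mgerm) : (z + x ≼ z + y) = (x ≼ y).
Proof. exact: mvmul0_leD2l (mgerm_mul x z). Qed.

Fact mgerm_addI (z : mgerm) : injective (+%R z).
Proof.
move=> x y h; apply: mgerm_le_anti; apply/andP; split.
  by rewrite -[_ x y](mgerm_leD2l z) h; exact: lle_refl.
by rewrite -[_ y x](mgerm_leD2l z) h; exact: lle_refl.
Qed.

Fact mgerm_addU (z x y : mgerm) : z + ljoin x y = ljoin (z + x) (z + y).
Proof.
by apply: val_inj; exact: mvmul0_joinr (mgerm_mul x z) (mgerm_mul y z).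
Qed.

Fact mgerm_addM (z x y : mgerm) : z + lmeet x y = lmeet (z + x) (z + y).
Proof. by apply: val_inj; exact: mvadd_meetr. Qed.

HB.instance Definition _ :=
  isCancLMonoid.Build mgerm mgerm_addI mgerm_leD2l mgerm_addU mgerm_addM.

(* G(M/O_M) *)
Definition stalk : lgroupType := diffgrp mgerm.

(* An embedding A/M -> A/O_M right inverse to the natural projection *)
Record splitting := Splitting {
  split_fun :> mvquot M -> mvquot (O_ M);
  split_embedding : mv_embedding split_fun;
  split_funK : forall u, quot_proj M (split_fun u) = u
}.

Variable s : splitting.

Lemma split_germ (a : A) :
  (mvpi (O_ M) a ⊖ s (mvpi M a) \in germ_set) /\
  (s (mvpi M a) ⊖ mvpi (O_ M) a \in germ_set).
Proof.
have /mvpi_eq[h1 h2] := split_funK s (mvpi M a).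
by rewrite -[s _]mvpi_repr -!mvpiB; split; exact: germ_setI.
Qed.

Definition g_ (a : A) : stalk :=
  diff_of (Germ (split_germ a).1)
  - diff_of (Germ (split_germ a).2).

End Germs.

Definition unitI (R : realType) : Type := {i01 R}.
HB.instance Definition _ (R : realType) := Choice.on (unitI R).

Section UnitInterval.
Variable R : realType.
Implicit Types x y z : {i01 R}.

Definition unitI0 : {i01 R} := 0%:i01.
Definition unitI_neg x : {i01 R} := (1 - x%:num)%:i01.
Definition unitI_add x y : {i01 R} := (Num.min 1 (x%:num + y%:num))%:i01.

Fact unitI_addA : associative unitI_add.
Proof.
move=> x y z; apply: val_inj => /=.
have x0 : 0 <= x%:num by []. have y0 : 0 <= y%:num by [].
have z0 : 0 <= z%:num by [].
move: (x%:num) (y%:num) (z%:num) x0 y0 z0 => a b c *.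
rewrite !minEle; case: (leP 1 (a + b)) => ?; case: (leP 1 (b + c)) => ?;
  do ![case: leP => ?]; lra.
Qed.

Fact unitI_addC : commutative unitI_add.
Proof. by move=> x y; apply: val_inj; rewrite /= addrC. Qed.

Fact unitI_add0 : right_id unitI0 unitI_add.
Proof.
by move=> x; apply: val_inj; rewrite /= addr0; apply/min_idPr; exact: le1.
Qed.

Fact unitI_negK : involutive unitI_neg.
Proof. by move=> x; apply: val_inj; rewrite /= opprB addrC subrK. Qed.

Fact unitI_add_neg0 x : unitI_add x (unitI_neg unitI0) = unitI_neg unitI0.
Proof.
apply: val_inj; rewrite /= subr0; apply/min_idPl.
by rewrite lerDr ge0.
Qed.

Fact unitI_luk x y :
  unitI_add (unitI_neg (unitI_add (unitI_neg x) y)) y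
  = unitI_add (unitI_neg (unitI_add (unitI_neg y) x)) x.
Proof.
apply: val_inj => /=.
have x0 : 0 <= x%:num by []. have x1 : x%:num <= 1 by [].
have y0 : 0 <= y%:num by []. have y1 : y%:num <= 1 by [].
move: (x%:num) (y%:num) x0 x1 y0 y1 => a b *.
rewrite !minEle; case: (leP 1 (1 - a + b)) => ?;
  case: (leP 1 (1 - b + a)) => ?; do ![case: leP => ?]; lra.
Qed.

HB.instance Definition _ := isMV.Build (unitI R)
  unitI_addA unitI_addC unitI_add0 unitI_negK unitI_add_neg0 unitI_luk.

(* The supremum of the empty set is 0, as in [0,1]. *)
Definition i01_vals (F : set (unitI R)) : set R :=
  [set (x : {i01 R})%:num | x in F].

Fact i01_sup_ge0 (F : set (unitI R)) : 0 <= sup (i01_vals F).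
Proof.
have [->|/set0P[x Fx]] := eqVneq F set0.
  by rewrite /i01_vals image_set0 sup0.
apply: (@le_trans _ _ (x : {i01 R})%:num); first exact: ge0.
by apply: ub_le_sup; [exists 1 => _ [y _ <-]; exact: le1|exists x].
Qed.

Fact i01_sup_le1 (F : set (unitI R)) : sup (i01_vals F) <= 1.
Proof.
have [->|/set0P[x Fx]] := eqVneq F set0.
  by rewrite /i01_vals image_set0 sup0 ler01.
apply: ge_sup; first by exists (x : {i01 R})%:num; exists x.
by move=> _ [y _ <-]; exact: le1.
Qed.

Definition i01_sup (F : set (unitI R)) : unitI R :=
  Itv01 (i01_sup_ge0 F) (i01_sup_le1 F).

End UnitInterval.

Section MVTopology.
Variable R : realType.

Definition fuzzy_set (X : Type) : Type := X -> unitI R.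

Definition fuzzy_join (X : Type) (F : set (fuzzy_set X)) : fuzzy_set X :=
  fun x => i01_sup [set f x | f in F].

Record is_mv_topology (X : Type) (T : set (fuzzy_set X)) : Prop := {
  mvtop0 : T (fun=> mv0);
  mvtop1 : T (fun=> mv1 _);
  mvtop_join : forall F : set (fuzzy_set X), F `<=` T -> T (fuzzy_join F);
  mvtop_mul : forall f g, T f -> T g -> T (fun x => f x ⊙ g x);
  mvtop_add : forall f g, T f -> T g -> T (fun x => f x ⊕ g x);
  mvtop_meet : forall f g, T f -> T g -> T (fun x => mvmeet (f x) (g x))
}.

Definition mv_topology_generated (X : Type) (G : set (fuzzy_set X)) :
    set (fuzzy_set X) :=
  [set f | forall T, is_mv_topology T -> G `<=` T -> T f].

Definition fuzzy_image (X Y : Type) (h : X -> Y) (f : fuzzy_set X) :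
    fuzzy_set Y :=
  fun y => i01_sup [set f x | x in [set x | h x = y]].

End MVTopology.

Section Hat.
Variables (R : realType) (A : mvAlgType).

(* The unique embedding A/M -> [0,1], which exists because A/M is simple;
   the default value of [xget] is never used. *)
Definition iota_ (M : maxIdeal A) : mvquot M -> unitI R :=
  xget (fun=> mv0) [set f | mv_embedding f].

Definition hat (a : A) : fuzzy_set R (maxIdeal A) :=
  fun M => iota_ (mvpi M a).

Definition tau_ : set (fuzzy_set R (maxIdeal A)) :=
  [set fuzzy_join F | F in [set F | F `<=` range hat]].

End Hat.

(* The data of a sheaf space of Abelian l-groups over an MV-topological
   space: the total space is a set of pairs (point, germ), projected by
   [projT1]. *)
Record mv_sheaf_data (R : realType) := MVSheafData {
  sh_base : Type;
  sh_base_top : set (fuzzy_set R sh_base);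
  sh_stalk : sh_base -> lgroupType;
  sh_total : set {x : sh_base & sh_stalk x};
  sh_total_top : set (fuzzy_set R (set_type sh_total))
}.

Section Sheaf.
Variables (R : realType) (A : mvAlgType).
Variable s : forall M : maxIdeal A, splitting M.

Definition tot_point (a : A) (M : maxIdeal A) :
    {N : maxIdeal A & stalk N} :=
  existT (fun N => stalk N : Type) M (g_ (s M) a).

Definition H_ : set {M : maxIdeal A & stalk M} :=
  [set y | exists a M, y = tot_point a M].

Definition H_proj (y : set_type H_) : maxIdeal A := projT1 (val y).

Definition tilde (a : A) (M : maxIdeal A) : set_type H_ :=
  exist (fun y => is_true (y \in H_)) (tot_point a M)
    (mem_set (ex_intro _ a (ex_intro _ M erefl))).

Definition H_top : set (fuzzy_set R (set_type H_)) :=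
  mv_topology_generated
    [set f | exists a b, f = fuzzy_image (tilde a) (hat R b)].

Definition associated_sheaf : mv_sheaf_data R :=
  MVSheafData (@tau_ R A) H_top.

(* The family {(a/M, g_aM)}_M; by [fuzzy_image_tilde] below, a/M is the value
   at (g_aM, M) of the image of [hat a] under [tilde a]. *)
Definition frak (a : A) : forall M : maxIdeal A, unitI R * stalk M :=
  fun M => (hat R a M, g_ (s M) a).

Definition frakA : choiceType := set_type (range frak).

Definition to_frak (a : A) : frakA :=
  exist (fun u => is_true (u \in range frak)) (frak a)
    (mem_set (ex_intro2 _ _ a I erefl)).

(* The operations of the algebra of families; since [to_frak] is onto, there
   is at most one structure with these operations. *)
Definition frak_operations (S : isMV frakA) : Prop :=
  let B := mvAlg_of S in
  [/\ to_frak mv0 = mv0 :> B,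
      forall a b, (to_frak a : B) ⊕ to_frak b = to_frak (a ⊕ b)
    & forall a, ¬ (to_frak a : B) = to_frak (¬ a)].

Lemma tildeK a : cancel (tilde a) H_proj. Proof. by []. Qed.

Lemma fuzzy_image_tilde a (f : fuzzy_set R (maxIdeal A)) M :
  fuzzy_image (tilde a) f (tilde a M) = f M.
Proof.
rewrite /fuzzy_image (_ : [set N | _] = [set M]).
  apply: val_inj => /=; rewrite /i01_vals !image_set1; exact: sup1.
by apply/seteqP; split => [N /(can_inj (tildeK a))|N ->].
Qed.

End Sheaf.

(* An algebra of global sections of an MV-sheaf of Abelian l-groups is one of
   the algebras of families attached to a locally retractive MV-algebra. *)
Inductive global_sections (R : realType) :
    mv_sheaf_data R -> mvAlgType -> Prop :=
  GlobalSections (A : mvAlgType) (s : forall M : maxIdeal A, splitting M)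
    (S : isMV (frakA R s)) of locally_retractive A & frak_operations S :
    global_sections (associated_sheaf R s) (mvAlg_of S).

(* Main.v *)
(** Everything reduces to injectivity of [a |-> frak a].  From [a/M = b/M] and
    [g_aM = g_bM] one gets [a/O_M = b/O_M]: the two terms of [g_aM] are
    disjoint, hence determined by their difference.  The intersection of all
    [O_M] is [0], because an ideal maximal among those avoiding [a <> 0] is
    prime and lies between a minimal prime and a maximal ideal.

    That [hat a M] determines [a/M] is Hölder's theorem for the simple chain
    [B = A/M], for which [iota_] would otherwise take its default value.  The
    embedding [f : B -> [0,1]] is read off binary expansions, so that
    [f x = f (2x) / 2] below one half and [f x = (1 + f (2x - 1)) / 2] above.
    Additivity says [f x + f y + f w = 1] whenever [x + y + w = 1]; doubling
    such a partition (or passing to [1 - 2x], [1 - 2y], [1 - 2w] if all three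
    parts are at most one half) gives another one with twice the defect, and
    the defect is bounded, so it vanishes.

    Splittings exist since [A/O_M] is local with radical [M/O_M]. *)
Require Import Defs.
From mathcomp Require Import all_boot all_order all_algebra.
From mathcomp Require Import all_classical all_reals.
From mathcomp Require Import interval_inference lra.

Set Implicit Arguments.
Unset Strict Implicit.
Unset Printing Implicit Defensive.

Import Order.TTheory GRing.Theory Num.Theory.

Local Open Scope classical_set_scope.
Local Open Scope ring_scope.
Local Open Scope mv_scope.

(** * Arithmetic in an MV-algebra: meets, multiples, disjoint elements *)

Section MVArithmetic.
Variable A : mvAlgType.
Implicit Types x y z t a b c p q : A.

Lemma mvle0 x : mvle mv0 x. Proof. by rewrite -[x]mvadd0 mvle_addl. Qed.

Lemma mvle1 x : mvle x (mv1 A). Proof. by rewrite mvleE mvadd1. Qed.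

Lemma mvle0_eq x : mvle x mv0 -> x = mv0.
Proof. by move=> x0; apply: mvle_anti x0 (mvle0 x). Qed.

Lemma mvle1_eq x : mvle (mv1 A) x -> x = mv1 A.
Proof. by move=> x1; apply: mvle_anti (mvle1 x) x1. Qed.

Lemma mvsubr0 x : x ⊖ mv0 = x.
Proof. by rewrite mvsubE mvadd0 mvnegK. Qed.

Lemma mvsub_le x y : mvle (x ⊖ y) x.
Proof. by rewrite mvle_sub mvle_addl. Qed.

Lemma mvaddACA x y z t : (x ⊕ y) ⊕ (z ⊕ t) = (x ⊕ z) ⊕ (y ⊕ t).
Proof. by rewrite !mvaddA -![x ⊕ _ ⊕ _]mvaddA [y ⊕ z]mvaddC. Qed.

Lemma mvle_sub2r z x y : mvle x y -> mvle (x ⊖ z) (y ⊖ z).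
Proof. by move=> xy; rewrite mvle_sub (mvle_trans xy) // mvle_subDl. Qed.

Lemma mvmulC x y : x ⊙ y = y ⊙ x.
Proof. by rewrite /mvmul mvaddC. Qed.

Lemma mvmul_subN x y : x ⊙ y = x ⊖ ¬ y.
Proof. by rewrite /mvsub mvnegK. Qed.

Lemma mvmeetC x y : mvmeet x y = mvmeet y x.
Proof. by rewrite /mvmeet mvjoinC. Qed.

Lemma mvsub_subK x y : x ⊖ (x ⊖ y) = mvmeet x y.
Proof. by rewrite [RHS]/mvmeet mvjoinC /mvjoin mvsubN mvsubE mvaddC. Qed.

Lemma mvsub_meetK x y : (x ⊖ y) ⊕ mvmeet x y = x.
Proof. by rewrite -mvsub_subK mvaddC mvle_subK // mvsub_le. Qed.

Lemma mvmul0P x y : x ⊙ y = mv0 <-> mvle x (¬ y).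
Proof. by rewrite mvmul_subN; split=> [h|/eqP //]; apply/eqP. Qed.

(** Adding the meet [t] of the two differences to [mvmeet x y] changes nothing, since the
    differences complete it to [x] and to [y]. That sum is not truncated, so [t] cancels to zero. *)
Lemma mvsub_meet0 x y : mvmeet (x ⊖ y) (y ⊖ x) = mv0.
Proof.
set t := mvmeet _ _.
have abs : mvmeet x y ⊕ t = mvmeet x y.
  rewrite mvadd_meetr ![mvmeet x y ⊕ _]mvaddC mvsub_meetK.
  by rewrite [mvmeet x y]mvmeetC mvsub_meetK mvmeetC.
have /mvmul0_addK <- : t ⊙ mvmeet x y = mv0; last first.
  by rewrite mvaddC abs; apply/eqP; exact: mvlexx.
apply/mvmul0P; apply: (mvle_trans (mvle_meetl _ _)).
rewrite mvle_sub; apply: (mvle_trans (mvle1 x)).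
by rewrite -(mvaddN y); apply/mvle_add2l; rewrite mvleN mvle_meetr.
Qed.

(** Distributing [⊕] over both meets turns the right side into a meet of four sums, three containing
    [c] and the fourth equal to [a ⊕ b]. *)
Lemma mvmeet_addr_le a b c :
  mvle (mvmeet c (a ⊕ b)) (mvmeet c a ⊕ mvmeet c b).
Proof.
rewrite mvadd_meetr ![mvmeet c a ⊕ _]mvaddC !mvadd_meetr.
rewrite !mvmeet_glb ![b ⊕ _]mvaddC mvle_meetr !(mvle_trans (mvle_meetl _ _)) //;
  by rewrite ?mvle_addl ?mvle_addr.
Qed.

Lemma mvmeet0_add a b c : mvmeet c a = mv0 -> mvmeet c b = mv0 ->
  mvmeet c (a ⊕ b) = mv0.
Proof.
by move=> ca cb; apply: mvle0_eq; have := mvmeet_addr_le a b c;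
  rewrite ca cb mvadd0.
Qed.

Definition mvmuln n x : A := iter n (mvadd x) mv0.

Lemma mvmulnS n x : mvmuln n.+1 x = x ⊕ mvmuln n x. Proof. by []. Qed.

Lemma mvmulnD m n x : mvmuln (m + n) x = mvmuln m x ⊕ mvmuln n x.
Proof. by elim: m => [|m IHm]; rewrite ?mv0add // addSn !mvmulnS IHm mvaddA. Qed.

Lemma mvmeet0_mulnr n a b : mvmeet a b = mv0 -> mvmeet a (mvmuln n b) = mv0.
Proof.
move=> ab; elim: n => [|n IHn]; last exact: mvmeet0_add.
by apply: mvle0_eq; exact: mvle_meetr.
Qed.

Lemma mvmeet0_muln m n a b : mvmeet a b = mv0 ->
  mvmeet (mvmuln m a) (mvmuln n b) = mv0.
Proof.
by move=> ab; rewrite mvmeetC mvmeet0_mulnr // mvmeetC mvmeet0_mulnr.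
Qed.

Lemma mvmeet0_exchange p q p' q' : mvmeet p q = mv0 ->
  p ⊕ q' = p' ⊕ q -> mvle p p'.
Proof.
move=> pq e; have: mvle p (mvmeet p (p' ⊕ q)).
  by rewrite mvmeet_glb mvlexx -e mvle_addr.
move=> /mvle_trans; apply; apply: (mvle_trans (mvmeet_addr_le _ _ _)).
by rewrite pq mvadd0 mvle_meetr.
Qed.

(* [x ⊙ y = mv0] says that the truncated sum [x ⊕ y] is an honest sum; this is
   the associativity of that partial addition. *)
Lemma mvmul0_addr x y z : x ⊙ y = mv0 -> (x ⊕ y) ⊙ z = mv0 ->
  x ⊙ (y ⊕ z) = mv0.
Proof.
move=> xy /mvmul0P xyz; apply/mvmul0P.
have -> : ¬ (y ⊕ z) = ¬ z ⊖ y by rewrite mvsubE mvnegK mvaddC.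
by rewrite -(mvmul0_addK xy); exact: mvle_sub2r.
Qed.

End MVArithmetic.

(** * Prime, minimal prime and maximal ideals, and the ideals [O_ M] *)

Section IdealTheory.
Variable A : mvAlgType.
Implicit Types (I J P Q : ideal A) (a x y : A).

Lemma ideal_muln I n x : I x -> I (mvmuln n x).
Proof. by move=> Ix; elim: n => [|n IHn]; [exact: ideal0|exact: idealD]. Qed.

Lemma proper_not1 I : Defs.proper I <-> ~ I (mv1 A).
Proof.
split=> [prI I1|nI1 IT]; last by apply: nI1; rewrite IT.
by apply: prI; apply/seteqP; split => // x _; exact: ideal_le (mvle1 x) I1.
Qed.

Lemma ideal_notN I x : Defs.proper I -> I x -> ~ I (¬ x).
Proof.
by move=> /proper_not1 nI1 Ix INx; apply: nI1; rewrite -(mvaddN x); exact: idealD.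
Qed.

Section Adjoin.
Variables (P : ideal A) (x : A).

Definition adjoin_set : set A :=
  [set z | exists m n, P m /\ mvle z (m ⊕ mvmuln n x)].

Fact adjoin0 : adjoin_set mv0.
Proof. by exists mv0, 0%N; split; [exact: ideal0|exact: mvle0]. Qed.

Fact adjoinD y z : adjoin_set y -> adjoin_set z -> adjoin_set (y ⊕ z).
Proof.
move=> [m [n [Pm ym]]] [m' [n' [Pm' zm']]]; exists (m ⊕ m'), (n + n')%N.
split; first exact: idealD.
apply: (mvle_trans (mvle_add ym zm')); rewrite mvmulnD mvaddACA.
exact: mvlexx.
Qed.

Fact adjoin_le y z : mvle y z -> adjoin_set z -> adjoin_set y.
Proof.
by move=> yz [m [n [Pm zm]]]; exists m, n; split; last exact: mvle_trans zm.
Qed.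

Definition adjoin : ideal A := Ideal adjoin0 adjoinD adjoin_le.

Lemma sub_adjoin : ideal_sub P adjoin.
Proof. by move=> m Pm; exists m, 0%N; split => //; exact: mvle_addr. Qed.

Lemma mem_adjoin : adjoin x.
Proof.
exists mv0, 1%N; split; first exact: ideal0.
by rewrite mv0add mvmulnS mvadd0 mvlexx.
Qed.

End Adjoin.

(** One application of Zorn's lemma serves twice: [a = mv1 A] gives the maximal ideals, a nonzero
    [a] gives a prime avoiding it. *)
Definition maximal_avoiding a P : Prop :=
  ~ P a /\ forall J, ideal_sub P J -> ~ J a -> ideal_sub J P.

Lemma maximal_avoiding_adjoin a P x : maximal_avoiding a P -> ~ P x ->
  exists m n, P m /\ mvle a (m ⊕ mvmuln n x).
Proof.
move=> [nPa maxP] nPx; apply/not_notP => nadj; apply: nPx.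
exact: (maxP (adjoin P x) (@sub_adjoin _ _) nadj) (mem_adjoin P x).
Qed.

(** If neither difference lies in [P], then [a] is below [m] plus a multiple of one and below [m']
    plus a multiple of the other. These multiples are disjoint, which leaves [a] below [m ⊕ m'],
    inside [P]. *)
Lemma maximal_avoiding_prime a P : maximal_avoiding a P -> is_prime P.
Proof.
move=> maxP; split=> [PT|x y]; first by apply: maxP.1; rewrite PT.
have [|nPxy] := pselect (P (x ⊖ y)); first by left.
have [|nPyx] := pselect (P (y ⊖ x)); first by right.
have [m [n [Pm am]]] := maximal_avoiding_adjoin maxP nPxy.
have [m' [n' [Pm' am']]] := maximal_avoiding_adjoin maxP nPyx.
exfalso; apply: maxP.1; apply: (@ideal_le _ _ _ (m ⊕ m')); last exact: idealD.
rewrite -[m ⊕ m']mvadd0 -(mvmeet0_muln n n' (mvsub_meet0 x y)) mvadd_meetr.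
rewrite mvmeet_glb (mvle_trans am) ?(mvle_trans am') //; apply: mvle_add2r.
  exact: mvle_addl.
exact: mvle_addr.
Qed.

Lemma is_maximalP P : is_maximal P <-> maximal_avoiding (mv1 A) P.
Proof.
split=> -[/proper_not1 nP1 maxP]; split=> // J.
  by move=> PJ /proper_not1 prJ; exact: maxP.
by move=> /proper_not1 prJ PJ; exact: maxP.
Qed.

(** Zorn's lemma for a preorder, so that ideals with the same elements need not be identified. *)
Lemma exists_maximal_avoiding a I : ~ I a ->
  exists2 P, maximal_avoiding a P & ideal_sub I P.
Proof.
move=> nIa; pose S J := ideal_sub I J /\ ~ J a; pose T := {J | S J}.
pose t0 : T := exist S I (conj (fun x Ix => Ix) nIa).
pose R (s t : T) : bool := `[< ideal_sub (sval s) (sval t) >].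
have [t|r s t /asboolP rs /asboolP st|F Ftot|[P [IP nPa]] maxP] :=
    ZL_preorder t0 (R := R).
- exact/asboolP.
- by apply/asboolP => x /rs /st.
(* A chain is bounded by its union, except the empty one, whose union does not contain [I]; there
   [I] itself serves. *)
- have [F0|/set0P[t Ft]] := eqVneq F set0.
    by exists t0 => s; rewrite F0.
  pose U : set A := [set x | exists2 s, F s & sval s x].
  have U0 : U mv0 by exists t => //; exact: ideal0.
  have UD x y : U x -> U y -> U (x ⊕ y).
    move=> [s Fs sx] [r Fr ry].
    have [/asboolP sr|/asboolP rs] := Ftot _ _ Fs Fr.
      by exists r => //; apply: idealD => //; exact: sr.
    by exists s => //; apply: idealD => //; exact: rs.
  have Ule x y : mvle x y -> U y -> U x.
    by move=> xy [s Fs sy]; exists s => //; exact: ideal_le xy sy.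
  have PU : ideal_sub I (Ideal U0 UD Ule) /\ ~ Ideal U0 UD Ule a.
    split=> [x Ix|[s Fs]]; last exact: (svalP s).2.
    by exists t => //; exact: (svalP t).1.
  by exists (exist S _ PU) => s Fs; apply/asboolP => x sx; exists s.
- exists P => //; split=> // J PJ nJa.
  have IJ : ideal_sub I J by move=> x /IP /PJ.
  by have /asboolP := maxP (exist S J (conj IJ nJa)) (asboolT PJ).
Qed.

Lemma exists_minimal_prime P : is_prime P ->
  exists2 Q, is_minimal_prime Q & ideal_sub Q P.
Proof.
move=> prP; pose S J := is_prime J /\ ideal_sub J P; pose T := {J | S J}.
pose t0 : T := exist S P (conj prP (fun x Px => Px)).
pose R (s t : T) : bool := `[< ideal_sub (sval t) (sval s) >].
have [t|r s t /asboolP rs /asboolP st|F Ftot|[Q [prQ QP]] minQ] :=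
    ZL_preorder t0 (R := R).
- exact/asboolP.
- by apply/asboolP => x /st /rs.
- have [F0|/set0P[t Ft]] := eqVneq F set0.
    by exists t0 => s; rewrite F0.
  pose K := ideal_inter [set J | exists2 s, F s & sval s = J].
  have Ks s : F s -> ideal_sub K (sval s) by move=> Fs x; apply; exists s.
  have KP : is_prime K /\ ideal_sub K P.
    split; last by move=> x /(Ks _ Ft) /(svalP t).2.
    split.
      apply/proper_not1 => /(Ks _ Ft); apply/proper_not1.
      by case: (svalP t) => -[].
    (* If one member of the chain misses [x ⊖ y] and another misses [y ⊖ x], the smaller of the two
       misses both, against its primeness. *)
    move=> x y; apply: contrapT => /not_orP[/existsNP[_ /not_implyP[[s Fs <-] nx]]].
    move=> /existsNP[_ /not_implyP[[r Fr <-] ny]].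
    have [/asboolP sr|/asboolP rs] := Ftot _ _ Fs Fr.
      by have [[_ /(_ x y)[/sr|]]] := svalP r.
    by have [[_ /(_ x y)[|/rs]]] := svalP s.
  by exists (exist S _ KP) => s Fs; apply/asboolP; exact: Ks.
- exists Q => //; split=> // J prJ JQ.
  have JP : ideal_sub J P by move=> x /JQ /QP.
  by have /asboolP := minQ (exist S J (conj prJ JP)) (asboolT JQ).
Qed.

Lemma O_inter_eq0 x : (forall M : maxIdeal A, O_ M x) -> x = mv0.
Proof.
move=> Ox; apply: contrapT => x0.
(* The zero ideal is among those intersected, so this starting point for Zorn's lemma avoids [x]. *)
have nI : ~ ideal_inter (@setT (ideal A)) x.
  move=> Ix; apply: x0.
  have D0 (y z : A) : y = mv0 -> z = mv0 -> y ⊕ z = mv0.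
    by move=> -> ->; exact: mvadd0.
  have le0 (y z : A) : mvle y z -> z = mv0 -> y = mv0.
    by move=> /[swap] ->; exact: mvle0_eq.
  exact: (Ix (Ideal (ideal_set := eq^~ mv0) erefl D0 le0)).
have [P /[dup] maxP /maximal_avoiding_prime prP _] := exists_maximal_avoiding nI.
have [Q minQ QP] := exists_minimal_prime prP.
have [M /is_maximalP maxM PM] :=
  exists_maximal_avoiding (iffLR (proper_not1 P) prP.1).
apply: maxP.1; apply/QP/(Ox (MaxIdeal maxM)); split=> // y /QP.
exact: PM.
Qed.

Lemma maximal_prime (M : maxIdeal A) : is_prime M.
Proof. exact/maximal_avoiding_prime/is_maximalP/max_idealP. Qed.

(** Adjoining [x] to [M] yields [1 = m ⊕ n x] with [m] in [M], so the complement of [n x] is below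
    [m]. *)
Lemma maximal_archimedean (M : maxIdeal A) x : ~ M x ->
  exists n, M (¬ mvmuln n x).
Proof.
move=> nMx; have /is_maximalP maxM := max_idealP M.
have [m [n [Mm]]] := maximal_avoiding_adjoin maxM nMx.
move=> h; exists n; apply: ideal_le Mm.
by rewrite mvleE mvnegK mvaddC; apply/eqP/mvle1_eq.
Qed.

(** Some minimal prime must lie below [M]: an intersection over the empty family would be all of
    [A]. *)
Lemma O_sub_maximal (M : maxIdeal A) : ideal_sub (O_ M) M.
Proof.
have [Q minQ QM] := exists_minimal_prime (maximal_prime M).
by move=> x /(_ Q); move/(_ (conj minQ QM))/QM.
Qed.

(* If [m ∈ M] and [¬ m ∈ N], then [m ⊖ ¬ m] is in every prime below [M], and
   [m ⊖ ¬ m ∈ N] would force [1 ∈ N]. *)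
Lemma O_sub_maximal_eq (M N : maxIdeal A) : ideal_sub (O_ M) N ->
  ideal_sub M N /\ ideal_sub N M.
Proof.
move=> ON.
have NM : ideal_sub N M.
  move=> y Ny; apply: contrapT => /maximal_archimedean[n MNn].
  have := ideal_muln n Ny; set m := ¬ mvmuln n y in MNn *.
  rewrite -[mvmuln n y]mvnegK -/m => NNm.
  have Om : O_ M (m ⊖ ¬ m).
    move=> Q [[[_ prQ] _] QM]; have [//|/QM Mm] := prQ m (¬ m).
    exfalso; apply: (ideal_notN (max_idealP M).1 MNn).
    by apply: ideal_le (mvle_subDl (¬ m) m) _; exact: idealD.
  have := ideal_notN (max_idealP N).1 NNm; rewrite mvnegK; apply.
  by apply: ideal_le (mvle_subDl m (¬ m)) _; apply: idealD => //; exact: ON.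
split=> //; exact: (max_idealP N).2 (max_idealP M).1 NM.
Qed.

End IdealTheory.

(** * Partitions of the unit and their doubling *)

Section PartialSums.
Variable B : mvAlgType.
Implicit Types x y z w d p q : B.

Lemma mvmul0_le2 x y z w : mvle x z -> mvle y w -> z ⊙ w = mv0 -> x ⊙ y = mv0.
Proof.
move=> xz yw /mvmul0P zw; apply/mvmul0P/(mvle_trans xz)/(mvle_trans zw).
by rewrite mvleN.
Qed.

Lemma mvmul0_addI x y z : x ⊙ z = mv0 -> y ⊙ z = mv0 ->
  x ⊕ z = y ⊕ z -> x = y.
Proof. by move=> xz yz e; rewrite -(mvmul0_addK xz) e mvmul0_addK. Qed.

(* x + y + w = 1 with no truncation in any partial sum *)
Definition partition1 x y w : Prop := x ⊙ y = mv0 /\ w = ¬ (x ⊕ y).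

Lemma partition1C x y w : partition1 x y w -> partition1 y x w.
Proof. by case=> xy ->; split; rewrite ?[y ⊙ _]mvmulC ?[y ⊕ _]mvaddC. Qed.

Lemma partition1AC x y w : partition1 x y w -> partition1 x w y.
Proof.
case=> xy ->; split; first by apply/mvmul0P; rewrite mvnegK mvle_addr.
by rewrite [_ ⊕ ¬ _]mvaddC -mvsubE mvaddC mvmul0_addK // mvmulC.
Qed.

(** Here [w] is at least one half, and [w ⊙ w] is [2w - 1]. *)
Lemma partition1_double x y w : partition1 x y w -> mvle (¬ w) w ->
  [/\ mvle x (¬ x), mvle y (¬ y) & partition1 (x ⊕ x) (y ⊕ y) (w ⊙ w)].
Proof.
move=> [xy ->]; rewrite mvnegK => /mvmul0P zz.
have yx : y ⊙ x = mv0 by rewrite mvmulC.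
split.
- by apply/mvmul0P/(mvmul0_le2 _ _ zz); exact: mvle_addr.
- by apply/mvmul0P/(mvmul0_le2 _ _ zz); exact: mvle_addl.
- split; last by rewrite /mvmul !mvnegK mvaddACA.
  (* Peeling summands off the untruncated sum [(x + y) + (x + y)] one at a time allows regrouping it
     as [2y + 2x]. *)
  have y_xy : y ⊙ (x ⊕ y) = mv0 := mvmul0_le2 (mvle_addl _ _) (mvlexx _) zz.
  have yy : y ⊙ y = mv0 := mvmul0_le2 (mvlexx _) (mvle_addl _ _) y_xy.
  have x_xyy : x ⊙ (y ⊕ (x ⊕ y)) = mv0 := mvmul0_addr xy zz.
  rewrite mvmulC; apply: (@mvmul0_addr _ (y ⊕ y) x x).
    rewrite mvmulC; apply: mvmul0_le2 (mvlexx _) _ x_xyy.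
    by apply: mvle_add2l; exact: mvle_addl.
  by rewrite mvmulC -mvaddA [y ⊕ x]mvaddC.
Qed.

Lemma mvnegD_sub x : ¬ (x ⊕ x) = ¬ x ⊖ x.
Proof. by rewrite mvsubE mvnegK. Qed.

(* With y = x + d, the two first differences are 1 - 2x = w + d and
   1 - 2y = w - d. *)
Lemma partition1_compl_le x y w : mvle x y -> partition1 x y w ->
  mvle y (¬ y) -> mvle w (¬ w) ->
  partition1 (¬ (x ⊕ x)) (¬ (y ⊕ y)) (¬ (w ⊕ w)).
Proof.
move=> xy_le pt yN /mvmul0P ww.
have [yx e_w] := partition1C pt.
have [yw e_x] := partition1AC (partition1C pt).
have [xw e_y] := partition1AC pt.
set d := y ⊖ x; set q := ¬ (y ⊕ y); set p := ¬ (x ⊕ x).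
have yE : y = x ⊕ d by rewrite mvaddC mvle_subK.
have dy : mvle d y := mvsub_le _ _.
have xd : x ⊙ d = mv0.
  apply/mvmul0P; rewrite -mvleN mvnegK /d /mvsub mvmulC mvmul_subN.
  exact: mvsub_le.
have eNx : ¬ x = w ⊕ d ⊕ x.
  by rewrite {1}e_x mvnegK {1}yE mvaddC [x ⊕ d]mvaddC mvaddA.
have x_wd : x ⊙ (w ⊕ d) = mv0.
  by rewrite [w ⊕ d]mvaddC mvmul0_addr // -yE.
have pE : p = w ⊕ d by rewrite /p mvnegD_sub eNx mvmul0_addK // mvmulC.
have yq : y ⊙ q = mv0.
  by apply/mvmul0P; rewrite /q mvnegK mvle_addr.
have x_qd : x ⊙ (q ⊕ d) = mv0.
  by rewrite [q ⊕ d]mvaddC mvmul0_addr // -yE.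
have qd : q ⊕ d = w.
  apply: (@mvmul0_addI _ _ x); rewrite 1?mvmulC //.
  rewrite -mvaddA [d ⊕ x]mvaddC -yE /q mvnegD_sub mvle_subK //.
  by rewrite {1}e_y mvnegK mvaddC.
split; last by rewrite pE -mvaddA [d ⊕ _]mvaddC qd.
rewrite mvmulC pE [w ⊕ d]mvaddC mvmul0_addr // ?qd //.
by rewrite mvmulC; exact: mvmul0_le2 dy (mvlexx _) yq.
Qed.

End PartialSums.

(** Iteration gives [|E t| * 2 ^ n <= C] for every [n], impossible for a nonzero [E t] in an
    archimedean field. *)
Lemma halving_eq0 (R : realType) (T : Type) (P : T -> Prop) (E : T -> R) (C : R) :
  (forall t, P t -> `|E t| <= C) ->
  (forall t, P t -> exists2 t', P t' & `|E t| <= `|E t'| / 2) ->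
  forall t, P t -> E t = 0.
Proof.
move=> EC halve t Pt.
have pow n : forall t, P t -> `|E t| * 2 ^+ n <= C.
  elim: n => [|n IHn] {Pt}t Pt; first by rewrite mulr1; exact: EC.
  have [t' Pt' le_tt'] := halve t Pt; apply: le_trans (IHn t' Pt').
  by rewrite exprS mulrA ler_pM2r ?exprn_gt0 // -ler_pdivlMr.
apply/eqP; rewrite -normr_le0; apply/ler_addgt0Pl => e e0; rewrite addr0.
have C0 : 0 <= C := le_trans (normr_ge0 _) (EC t Pt).
pose n := Num.bound (C / e).
have := archi_boundP (divr_ge0 C0 (ltW e0)); rewrite -/n ltr_pdivrMr // => ltC.
rewrite leNgt; apply/negP => lte; have := pow n t Pt; rewrite leNgt => /negP.
apply; apply: (lt_trans ltC); rewrite mulrC.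
rewrite (lt_le_trans (y := e * 2 ^+ n)) //.
  by rewrite ltr_pM2l // -natrX ltr_nat ltn_expl.
by rewrite ler_pM2r ?exprn_gt0 // ltW.
Qed.

(** * Hölder embedding of an archimedean MV-chain into the unit interval *)

Section HolderEmbedding.
Variables (R : realType) (B : mvAlgType).
Hypothesis nontrivial : mv1 B <> mv0.
Hypothesis chain : forall x y : B, mvle x y \/ mvle y x.
Implicit Types x y z w d p q : B.

(** The expansion truncated to [n] digits. Where [x = ¬ x] the digit [0] is chosen, so that one half
    reads [0.0111...]. *)
Fixpoint binary (n : nat) x : R :=
  if n is m.+1 then
    if mvle x (¬ x) then binary m (x ⊕ x) / 2 else (1 + binary m (x ⊙ x)) / 2
  else 0.

Lemma binary_ge0 n x : 0 <= binary n x.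
Proof.
elim: n x => [|n IHn] x //=; case: ifP => _; first by have := IHn (x ⊕ x); lra.
by have := IHn (x ⊙ x); lra.
Qed.

Lemma binary_le1 n x : binary n x <= 1.
Proof.
elim: n x => [|n IHn] x //=; case: ifP => _; first by have := IHn (x ⊕ x); lra.
by have := IHn (x ⊙ x); lra.
Qed.

Lemma binary_nondecr n x : binary n x <= binary n.+1 x.
Proof.
elim: n x => [|n IHn] x; first exact: binary_ge0.
rewrite [X in X <= _]/= [X in _ <= X]/=.
case: ifP => _; first by have := IHn (x ⊕ x); rewrite /=; lra.
by have := IHn (x ⊙ x); rewrite /=; lra.
Qed.

Definition real_value x : R := sup (range (binary ^~ x)).

Lemma binary_le_value n x : binary n x <= real_value x.
Proof.
apply: ub_le_sup; last by exists n.
by exists 1 => _ [m _ <-]; exact: binary_le1.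
Qed.

Lemma value_le x (c : R) : (forall n, binary n x <= c) -> real_value x <= c.
Proof.
move=> h; apply: ge_sup; first by exists (binary 0 x), 0%N.
by move=> _ [n _ <-].
Qed.

Lemma value_ge0 x : 0 <= real_value x.
Proof. exact: (binary_le_value 0). Qed.

Lemma value_le1 x : real_value x <= 1.
Proof. by apply: value_le => n; exact: binary_le1. Qed.

Lemma value_low x : mvle x (¬ x) -> real_value x = real_value (x ⊕ x) / 2.
Proof.
move=> xN; have step n : binary n.+1 x = binary n (x ⊕ x) / 2 by rewrite /= xN.
apply/le_anti/andP; split.
  (* One digit more is allowed by monotonicity and exposes the recursive step. *)
  apply: value_le => n; apply: le_trans (binary_nondecr n x) _.
  by rewrite step ler_pM2r ?invr_gt0 // binary_le_value.
rewrite ler_pdivrMr //; apply: value_le => n.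
by rewrite -ler_pdivrMr // -step binary_le_value.
Qed.

Lemma value0 : real_value mv0 = 0.
Proof. by have := value_low (mvle0 _); rewrite mvadd0; lra. Qed.

Lemma value_high_strict x : ~~ mvle x (¬ x) ->
  real_value x = (1 + real_value (x ⊙ x)) / 2.
Proof.
move=> xN.
have step n : binary n.+1 x = (1 + binary n (x ⊙ x)) / 2.
  by rewrite /= (negPf xN).
apply/le_anti/andP; split.
  apply: value_le => n; apply: le_trans (binary_nondecr n x) _.
  by rewrite step ler_pM2r ?invr_gt0 // lerD2l binary_le_value.
rewrite ler_pdivrMr // -lerBrDl; apply: value_le => n.
by rewrite lerBrDl -ler_pdivrMr // -step binary_le_value.
Qed.

Lemma value1 : real_value (mv1 B) = 1.
Proof.
have := @value_high_strict (mv1 B).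
rewrite /mvmul mvneg1 mvadd0 => h; suff: ~~ mvle (mv1 B) mv0 by move=> /h; lra.
by apply/negP => /mvle0_eq.
Qed.

(** The only new case is [x = ¬ x], where [x ⊕ x] is the unit and [x ⊙ x] is zero, so both formulas
    give one half. *)
Lemma value_high x : mvle (¬ x) x -> real_value x = (1 + real_value (x ⊙ x)) / 2.
Proof.
move=> Nx; have [xN|] := boolP (mvle x (¬ x)); last exact: value_high_strict.
have -> : x ⊙ x = mv0 by exact/mvmul0P.
by rewrite value0 value_low // {1}(mvle_anti xN Nx) mvaddC mvaddN value1 addr0.
Qed.

(** The doubling argument for two parts: the one that is at most one half doubles by [⊕], the other
    by [⊙]. The results are again complementary, with twice the defect [E]. *)
Lemma value_neg x : real_value (¬ x) = 1 - real_value x.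
Proof.
pose E x : R := real_value x + real_value (¬ x) - 1.
suff: E x = 0 by rewrite /E; lra.
apply: (@halving_eq0 R B (fun=> True) E 1) => // {}x _.
  rewrite /E ler_norml; have := value_ge0 x; have := value_le1 x.
  by have := value_ge0 (¬ x); have := value_le1 (¬ x); lra.
have EN y : E (¬ y) = E y by rewrite /E mvnegK; lra.
have step y : mvle y (¬ y) -> `|E y| <= `|E (y ⊕ y)| / 2.
  move=> yN; rewrite /E (value_low yN) (@value_high (¬ y)) ?mvnegK //.
  rewrite /mvmul !mvnegK.
  set u := real_value _; set v := real_value _.
  have -> : u / 2 + (1 + v) / 2 - 1 = (u + v - 1) / 2 by lra.
  by rewrite normrM [`|2^-1|]ger0_norm // invr_ge0.
have [xN|Nx] := chain x (¬ x); first by exists (x ⊕ x) => //; exact: step.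
exists (¬ x ⊕ ¬ x) => //; rewrite -EN; apply: step; by rewrite mvnegK.
Qed.

Lemma partition1_compl x y w : partition1 x y w ->
  mvle x (¬ x) -> mvle y (¬ y) -> mvle w (¬ w) ->
  partition1 (¬ (x ⊕ x)) (¬ (y ⊕ y)) (¬ (w ⊕ w)).
Proof.
move=> pt xN yN wN; have [xy|yx] := chain x y.
  exact: partition1_compl_le.
by apply/partition1C/partition1_compl_le => //; exact: partition1C.
Qed.

Lemma value_partition1 x y w : partition1 x y w ->
  real_value x + real_value y + real_value w = 1.
Proof.
pose E (t : B * B * B) : R :=
  real_value t.1.1 + real_value t.1.2 + real_value t.2 - 1.
move=> pt; suff: E (x, y, w) = 0 by rewrite /E /=; lra.
(* With three values in the unit interval the defect lies between [-1] and [2], whence the bound. *)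
apply: (@halving_eq0 R _ (fun t => partition1 t.1.1 t.1.2 t.2) E 2) => //
  -[[{pt}x {}y] {}w] /= pt.
  rewrite /E /= ler_norml; have := value_ge0 x; have := value_le1 x.
  have := value_ge0 y; have := value_le1 y.
  by have := value_ge0 w; have := value_le1 w; lra.
(* The case of a part that is at least one half; permuting the parts brings it to the last place. *)
have high x' y' w' : partition1 x' y' w' -> mvle (¬ w') w' ->
    exists2 t, partition1 t.1.1 t.1.2 t.2 & `|E (x', y', w')| <= `|E t| / 2.
  move=> pt' Nw; have [xN yN pt2] := partition1_double pt' Nw.
  exists (x' ⊕ x', y' ⊕ y', w' ⊙ w') => //.
  rewrite /E /= (value_low xN) (value_low yN) (value_high Nw).
  set a := real_value _; set b := real_value _; set c := real_value _.
  have -> : a / 2 + b / 2 + (1 + c) / 2 - 1 = (a + b + c - 1) / 2 by lra.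
  by rewrite normrM [`|2^-1|]ger0_norm // invr_ge0.
have [wN|Nw] := chain w (¬ w); last exact: high.
have [yN|Ny] := chain y (¬ y); last first.
  have [t ht le_t] := high _ _ _ (partition1AC pt) Ny; exists t => //.
  by apply: le_trans le_t; rewrite /E /= [X in `|X - 1| <= _]addrAC.
have [xN|Nx] := chain x (¬ x); last first.
  have [t ht le_t] := high _ _ _ (partition1AC (partition1C pt)) Nx.
  by exists t => //; apply: le_trans le_t; rewrite /E /=
    -[X in `|X - 1| <= _]addrA [X in `|X - 1| <= _]addrC.
(* All parts are at most one half; the defect doubles and changes sign. *)
exists (¬ (x ⊕ x), ¬ (y ⊕ y), ¬ (w ⊕ w)); first exact: partition1_compl.
rewrite /E /= !value_neg (value_low xN) (value_low yN) (value_low wN).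
set a := real_value _; set b := real_value _; set c := real_value _.
have -> : a / 2 + b / 2 + c / 2 - 1 = - (1 - a + (1 - b) + (1 - c) - 1) / 2 by lra.
by rewrite normrM normrN [`|2^-1|]ger0_norm // invr_ge0.
Qed.

Lemma value_add x y : x ⊙ y = mv0 ->
  real_value (x ⊕ y) = real_value x + real_value y.
Proof.
move=> xy; have := @value_partition1 x y _ (conj xy erefl).
by rewrite value_neg; lra.
Qed.

Lemma value_mono x y : mvle x y -> real_value x <= real_value y.
Proof.
move=> xy; rewrite -(mvle_subK xy) value_add ?lerDr ?value_ge0 //.
apply/mvmul0P; rewrite /mvsub mvmulC mvmul_subN; exact: mvsub_le.
Qed.

(** By totality either [x] is below [¬ y] and the sum is untruncated, or the sum is the unit. *)
Lemma value_addE x y :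
  real_value (x ⊕ y) = Num.min 1 (real_value x + real_value y).
Proof.
have [xy|Nxy] := chain x (¬ y).
  rewrite -value_add; last exact/mvmul0P.
  by rewrite min_r // value_le1.
have -> : x ⊕ y = mv1 B.
  by apply: mvle1_eq; rewrite -(mvaddN y) mvaddC; exact: mvle_add2r.
by rewrite value1 min_l //; have := value_mono Nxy; rewrite value_neg; lra.
Qed.

Definition holder_embedding x : unitI R := Itv01 (value_ge0 x) (value_le1 x).

Lemma holder_embedding_hom : mv_hom holder_embedding.
Proof.
split; first by apply: val_inj; rewrite /= value0.
  by move=> x y; apply: val_inj; rewrite /= value_addE.
by move=> x; apply: val_inj; rewrite /= value_neg.
Qed.

Hypothesis archimedean : forall x, x <> mv0 -> exists n, mvmuln n x = mv1 B.

(** A zero value passes to all multiples of [x], whereas some multiple of a nonzero [x] is the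
    unit. *)
Lemma value_eq0 x : real_value x = 0 -> x = mv0.
Proof.
move=> fx0; apply: contrapT => /archimedean[n nx1].
have le_muln m : real_value (mvmuln m x) <= 0.
  elim: m => [|m IHm]; first by rewrite value0.
  by rewrite mvmulnS value_addE fx0 add0r ge_min IHm orbT.
by have := le_muln n; rewrite nx1 value1; lra.
Qed.

Lemma holder_embedding_inj : injective holder_embedding.
Proof.
have le_eq x y : real_value x = real_value y -> mvle x y -> x = y.
  move=> e xy; have := mvle_subK xy => yE.
  suff: real_value (y ⊖ x) = 0 by move=> /value_eq0 d0; rewrite -yE d0 mv0add.
  have: real_value y = real_value (y ⊖ x) + real_value x.
    rewrite -{1}yE value_add //; apply/mvmul0P.
    by rewrite /mvsub mvmulC mvmul_subN; exact: mvsub_le.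
  by rewrite e; lra.
move=> x y /(congr1 val) /= e; have [|] := chain x y; first exact: le_eq.
by move=> yx; apply/esym/le_eq.
Qed.

End HolderEmbedding.

(** * Correspondence between ideals of [A] and of a quotient *)

Section QuotientTheory.
Variables (A : mvAlgType) (I : ideal A).
Implicit Types x y : A.

Lemma mvpi_eq0 x : mvpi I x = mv0 <-> I x.
Proof.
rewrite -mvpi0 mvpi_eq mvsubr0; split=> [[]//|Ix]; split=> //.
by apply: ideal_le Ix; apply: (mvle_trans (mvsub_le _ _)); exact: mvle0.
Qed.

Lemma mvpi1 : mvpi I (mv1 A) = mv1 (mvquot I).
Proof. by rewrite mvpiN. Qed.

Lemma mvpi_muln n x : mvpi I (mvmuln n x) = mvmuln n (mvpi I x).
Proof. by elim: n => //= n IHn; rewrite mvpiD IHn. Qed.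

Lemma mvpi_le x y : mvle (mvpi I x) (mvpi I y) <-> I (x ⊖ y).
Proof. by rewrite -mvpi_eq0 mvpiB; split=> /eqP. Qed.

Section PreimageIdeal.
Variable K : ideal (mvquot I).

Definition preimage_set : set A := [set x | K (mvpi I x)].

Fact preimage0 : preimage_set mv0. Proof. exact: ideal0. Qed.

Fact preimageD x y : preimage_set x -> preimage_set y -> preimage_set (x ⊕ y).
Proof. by rewrite /preimage_set /= mvpiD; exact: idealD. Qed.

Fact preimage_le x y : mvle x y -> preimage_set y -> preimage_set x.
Proof.
move=> /eqP xy; apply: ideal_le; apply/mvpi_le; rewrite xy; exact: ideal0.
Qed.

Definition preimage_ideal : ideal A := Ideal preimage0 preimageD preimage_le.

Lemma sub_preimage_ideal : ideal_sub I preimage_ideal.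
Proof. by move=> x /mvpi_eq0 x0; rewrite /= /preimage_set /= x0; exact: ideal0. Qed.

Lemma preimage_proper : Defs.proper K -> Defs.proper preimage_ideal.
Proof. by rewrite !proper_not1 /= /preimage_set /= mvpi1. Qed.

End PreimageIdeal.

Section QuotientIdeal.
Variables (J : ideal A) (IJ : ideal_sub I J).

(** The image [J/I], read on chosen representatives; the choice is immaterial because [I] is
    contained in [J]. *)
Definition quotient_set : set (mvquot I) := [set u | J (repr u)].

Lemma mem_quotient_set x : quotient_set (mvpi I x) <-> J x.
Proof.
have /mvpi_eq[/IJ h1 /IJ h2] := mvpi_repr (mvpi I x).
split=> Jx; first by apply: ideal_le (mvle_subDr _ _) _; exact: idealD h2 Jx.
by apply: ideal_le (mvle_subDr _ x) _; exact: idealD.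
Qed.

Fact quotient0 : quotient_set mv0.
Proof. by rewrite -mvpi0; apply/mem_quotient_set; exact: ideal0. Qed.

Fact quotientD u v : quotient_set u -> quotient_set v -> quotient_set (u ⊕ v).
Proof.
rewrite -(mvpi_repr u) -(mvpi_repr v) -mvpiD !mem_quotient_set.
exact: idealD.
Qed.

Fact quotient_le u v : mvle u v -> quotient_set v -> quotient_set u.
Proof.
rewrite -(mvpi_repr u) -(mvpi_repr v) mvpi_le !mem_quotient_set => /IJ Juv Jv.
by apply: ideal_le (mvle_subDr _ (repr v)) _; exact: idealD.
Qed.

Definition quotient_ideal : ideal (mvquot I) :=
  Ideal quotient0 quotientD quotient_le.

End QuotientIdeal.
End QuotientTheory.

(** * The quotients [A/M] and [A/O_M], splittings and stalk elements *)

Section MaximalQuotient.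
Variables (R : realType) (A : mvAlgType) (M : maxIdeal A).

Lemma iota_embedding : mv_embedding (@iota_ R A M).
Proof.
rewrite /iota_; apply: (@xgetPex _ _ [set f | mv_embedding f]).
(* The three hypotheses of the Hölder embedding come from [M] being proper, prime and maximal. *)
have nt : mv1 (mvquot M) <> mv0.
  by rewrite -mvpi1 => /mvpi_eq0; apply/proper_not1; exact: (max_idealP M).1.
have chain (u v : mvquot M) : mvle u v \/ mvle v u.
  rewrite -(mvpi_repr u) -(mvpi_repr v) !mvpi_le.
  exact: (maximal_prime M).2.
have arch (u : mvquot M) : u <> mv0 -> exists n, mvmuln n u = mv1 _.
  rewrite -(mvpi_repr u) => /mvpi_eq0 /maximal_archimedean[n Mn]; exists n.
  apply: mvle1_eq; rewrite -mvpi_muln -mvpi1; apply/mvpi_le.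
  by rewrite mvsubE /mv1 mvnegK mv0add.
exists (@holder_embedding R (mvquot M)).
split; [exact: holder_embedding_hom|exact: holder_embedding_inj].
Qed.

Lemma hat_eq (a b : A) : hat R a M = hat R b M -> mvpi M a = mvpi M b.
Proof. exact: iota_embedding.2. Qed.

(* [A / O_M] is local, with maximal ideal [M / O_M]. *)
Lemma Rad_O (x : A) : Rad (mvquot (O_ M)) (mvpi (O_ M) x) <-> M x.
Proof.
pose OM := @O_sub_maximal A M; pose Mq := quotient_ideal OM.
have memMq y : Mq (mvpi (O_ M) y) <-> M y := mem_quotient_set OM y.
have [prM maxM] := max_idealP M.
have maxMq : is_maximal Mq.
  split=> [|K prK MqK u].
    by apply/proper_not1; rewrite -mvpi1 memMq; exact/proper_not1.
  rewrite -(mvpi_repr u) memMq => Ku.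
  apply: (maxM _ (preimage_proper prK)) => // y My.
  by apply: MqK; apply/memMq.
split=> [/(_ _ maxMq)/memMq //|Mx N [prN maxN]].
(* The preimage of another maximal ideal [N] extends to a maximal ideal of [A]; it contains [O_ M],
   hence equals [M]. *)
have /proper_not1 := preimage_proper prN.
move=> /exists_maximal_avoiding[M2 /is_maximalP maxM2 NM2].
have [MM2 M2M] : ideal_sub M M2 /\ ideal_sub M2 M.
  apply: (@O_sub_maximal_eq _ M (MaxIdeal maxM2)) => y /=.
  by move=> Oy; apply: NM2; exact: sub_preimage_ideal.
apply: (maxN _ maxMq.1); last exact/memMq.
by move=> u; rewrite -(mvpi_repr u) => Nu; apply/memMq/M2M/NM2.
Qed.

(** By [Rad_O], the algebras [A/M] and [(A/O_M)/Rad] are quotients of [A] by the same congruence, so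
    the retraction [j] can be read on [A/M]. *)
Lemma exists_splitting : retractive_radical (mvquot (O_ M)) ->
  exists _ : splitting M, True.
Proof.
move=> [j [[[j0 jD jN] jI] jK]].
pose r x := mvpi (Rad (mvquot (O_ M))) (mvpi (O_ M) x).
have rE x y : r x = r y <-> mvpi M x = mvpi M y.
  by rewrite /r !mvpi_eq -!mvpiB !Rad_O.
pose s (u : mvquot M) := j (r (repr u)).
have sE x : s (mvpi M x) = j (r x).
  by congr j; apply/rE; rewrite mvpi_repr.
suff [sP sK] : mv_embedding s /\ forall u, quot_proj M (s u) = u.
  by exists (Splitting sP sK).
split; first split; first split.
- by rewrite -mvpi0 sE /r !mvpi0.
- move=> u v; rewrite -(mvpi_repr u) -(mvpi_repr v) -mvpiD !sE.
  by rewrite /r !mvpiD.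
- by move=> u; rewrite -(mvpi_repr u) -mvpiN !sE /r !mvpiN.
- move=> u v; rewrite -(mvpi_repr u) -(mvpi_repr v) !sE => /jI.
  by move=> /rE.
- move=> u; rewrite -[RHS]mvpi_repr; apply/rE.
  by rewrite /r mvpi_repr jK.
Qed.

Lemma diff_of_sub_eq (p q p' q' : mgerm M) :
  (diff_of p - diff_of q : stalk M) = diff_of p' - diff_of q' ->
  val p ⊕ val q' = val p' ⊕ val q.
Proof.
move=> /eqP; rewrite subr_eq addrAC eq_sym subr_eq eq_sym => /eqP.
rewrite /diff_of [LHS]diff_addE [RHS]diff_addE => /dpi_eq /=.
by rewrite !addr0 => /(congr1 val).
Qed.

Lemma g_eq (s : splitting M) (a b : A) :
  mvpi M a = mvpi M b -> g_ s a = g_ s b -> mvpi (O_ M) a = mvpi (O_ M) b.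
Proof.
move=> ab /diff_of_sub_eq /=; rewrite -ab.
move: (mvpi (O_ M) a) (mvpi (O_ M) b) (s (mvpi M a)) => u v c e.
have uc_vc : u ⊖ c = v ⊖ c.
  apply: mvle_anti; first exact: mvmeet0_exchange (mvsub_meet0 u c) e.
  exact: mvmeet0_exchange (mvsub_meet0 v c) (esym e).
have cu_cv : c ⊖ u = c ⊖ v.
  have e' : (c ⊖ u) ⊕ (v ⊖ c) = (c ⊖ v) ⊕ (u ⊖ c).
    by rewrite mvaddC -e mvaddC.
  apply: mvle_anti; first exact: mvmeet0_exchange (mvsub_meet0 c u) e'.
  exact: mvmeet0_exchange (mvsub_meet0 c v) (esym e').
(* Both differences with [c] determine [u]: it is [(u ⊖ c) ⊕ mvmeet u c], and the meet is
   [c ⊖ (c ⊖ u)]. *)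
rewrite -(mvsub_meetK u c) -[RHS](mvsub_meetK v c) uc_vc.
by rewrite [mvmeet u c]mvmeetC [mvmeet v c]mvmeetC -!mvsub_subK cu_cv.
Qed.

End MaximalQuotient.

(** * Transport of an MV-structure along a bijection *)

Section Transport.
Variables (A : mvAlgType) (T : choiceType) (f : A -> T) (g : T -> A).
Hypotheses (fK : cancel f g) (gK : cancel g f).

Let add x y := f (g x ⊕ g y).
Let neg x := f (¬ g x).

Fact transport_addA : associative add.
Proof. by move=> x y z; rewrite /add !fK mvaddA. Qed.

Fact transport_addC : commutative add.
Proof. by move=> x y; rewrite /add mvaddC. Qed.

Fact transport_add0 : right_id (f mv0) add.
Proof. by move=> x; rewrite /add fK mvadd0 gK. Qed.

Fact transport_negK : involutive neg.
Proof. by move=> x; rewrite /neg fK mvnegK gK. Qed.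

Fact transport_add_neg0 x : add x (neg (f mv0)) = neg (f mv0).
Proof. by rewrite /add /neg !fK mvadd_neg0. Qed.

Fact transport_luk x y :
  add (neg (add (neg x) y)) y = add (neg (add (neg y) x)) x.
Proof. by rewrite /add /neg !fK mv_luk. Qed.

Definition transport_isMV : isMV T :=
  isMV.Build T transport_addA transport_addC transport_add0 transport_negK
    transport_add_neg0 transport_luk.

End Transport.

(** * The isomorphism between [A] and its algebra of families *)

Section FrakIsomorphism.
Variables (R : realType) (A : mvAlgType).
Variable s : forall M : maxIdeal A, splitting M.

Lemma to_frak_inj : injective (to_frak R s).
Proof.
move=> a b /(congr1 val) /= ab.
have eqO M : mvpi (O_ M) a = mvpi (O_ M) b.
  have [/hat_eq eqM eqg] : hat R a M = hat R b M /\ g_ (s M) a = g_ (s M) b.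
    by have := congr1 (fun h => h M) ab; rewrite /frak => -[].
  exact: g_eq eqM eqg.
by apply: mvle_anti; apply/eqP/O_inter_eq0 => M; have /mvpi_eq[] := eqO M.
Qed.

Lemma to_frak_surj (u : frakA R s) : exists a, to_frak R s a = u.
Proof. by have [a _ au] := set_mem (valP u); exists a; exact: val_inj. Qed.

(** Since [to_frak] is bijective, the structure carried over from [A] has exactly the prescribed
    operations. *)
Lemma frak_isomorphic : exists S : isMV (frakA R s),
  frak_operations S /\ mv_isomorphic A (mvAlg_of S).
Proof.
pose g u := sval (cid (to_frak_surj u)).
have gK : cancel g (to_frak R s) by move=> u; rewrite /g; case: cid.
have fK : cancel (to_frak R s) g by move=> a; apply: to_frak_inj; rewrite gK.
have ops : frak_operations (transport_isMV fK gK).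
  by split=> // [a b|a]; rewrite /mvadd /mvneg /= !fK.
exists (transport_isMV fK gK); split=> //.
exists (to_frak R s); split; last by exists g.
by case: ops => f0 fD fN; split=> [//|x y|x]; rewrite ?fD ?fN.
Qed.

End FrakIsomorphism.

Theorem theorem7p5 (R : realType) (A : mvAlgType)
    (hA : locally_retractive A) :
  (forall s : (forall M : maxIdeal A, splitting M),
     exists S : isMV (frakA R s),
       frak_operations S /\ mv_isomorphic A (mvAlg_of S))
  /\ (exists (F : mv_sheaf_data R) (B : mvAlgType),
       global_sections F B /\ mv_isomorphic A B).
Proof.
split=> [s|]; first exact: frak_isomorphic.
(* The second claim needs one actual family of splittings; local retractivity supplies it at each
   [M]. *)
pose s (M : maxIdeal A) := sval (cid (exists_splitting (hA M))).
have [S [ops iso]] := frak_isomorphic R s.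
by exists (associated_sheaf R s), (mvAlg_of S); split.
Qed.
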